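(* Let $C\subset\mathbb P^2$ be an irreducible cuspidal curve over $\mathbb C$ of degree $d\geq 2$, having $c$ ordinary cusps and $n$ nodes. Then $$8c+6n\leq 3d(d-2)-\frac{1-(-1)^d}{2}.$$
   Context: A reduced curve $C\subset\mathbb P^2$ over $\mathbb C$ is called cuspidal if its only singular points are ordinary cusps (locally analytically $x^2=y^3$) and ordinary nodes (locally analytically $xy=0$). *)

(* Defs.v *)
From mathcomp Require Import all_boot all_order all_algebra complex.
From mathcomp Require Import all_classical all_reals all_analysis.
(* The notations of [mpoly] clash with those of the analysis library: only its
   structure instances are imported. *)
From mathcomp Require Import (canonicals, coercions) mpoly.

Set Implicit Arguments.
Unset Strict Implicit.
Unset Printing Implicit Defensive.

Import Order.TTheory GRing.Theory Num.Theory numFieldNormedType.Exports.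
Local Open Scope classical_set_scope.
Local Open Scope ring_scope.

Definition irreducible_elt (A : unitRingType) (a : A) : Prop :=
  [/\ a != 0, a \isn't a GRing.unit &
      forall b c : A, a = b * c -> b \is a GRing.unit \/ c \is a GRing.unit].

(* The definitions are given over a numFieldType [K], whose order and norm are
   those of the complex numbers when [K] is [R[i]] with [R : realType]. *)

Section AnalyticGerms.
Variable K : numFieldType.
Implicit Types (f g u : 'rV[K]_2 -> K) (phi psi : 'rV[K]_2 -> 'rV[K]_2).
Implicit Types p q : 'rV[K]_2.

(* Absolute convergence (bounded partial sums of the norms) makes the choice of
   square partial sums immaterial. *)
Definition power_series_sums_to (a : nat -> nat -> K) (h : 'rV[K]_2) (l : K) :
    Prop :=
  (exists M : K, forall n : nat,
     \sum_(i < n) \sum_(j < n) `|a i j * h 0 0 ^+ i * h 0 1 ^+ j| <= M) /\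
  (fun n : nat => \sum_(i < n) \sum_(j < n) a i j * h 0 0 ^+ i * h 0 1 ^+ j)
    @ \oo --> l.

Definition analytic_at f p : Prop :=
  exists a : nat -> nat -> K,
    \forall h \near (0 : 'rV[K]_2), power_series_sums_to a h (f (p + h)).

Definition analytic_map_at phi p : Prop :=
  forall j : 'I_2, analytic_at (fun z => phi z 0 j) p.

Definition local_analytic_iso phi p q : Prop :=
  [/\ phi p = q, analytic_map_at phi p &
      exists psi, [/\ psi q = p, analytic_map_at psi q,
        \forall z \near p, psi (phi z) = z &
        \forall w \near q, phi (psi w) = w]].

(* The germ at [p] of the curve of equation [f] is isomorphic to the germ at [q]
   of the curve of equation [g]: a local change of coordinates carries the ideal
   generated by [g] to the ideal generated by [f], i.e. the two equations
   correspond up to an invertible analytic factor. *)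
Definition analytically_equivalent f p g q : Prop :=
  exists phi u,
    [/\ local_analytic_iso phi p q, analytic_at u p, u p != 0 &
        \forall z \near p, f z = u z * g (phi z)].

Definition cusp_equation (z : 'rV[K]_2) : K := z 0 0 ^+ 2 - z 0 1 ^+ 3.
Definition node_equation (z : 'rV[K]_2) : K := z 0 0 * z 0 1.

End AnalyticGerms.

Section PlaneCurves.
Variable K : numFieldType.

(* Points of the projective plane are the lines through the origin of K^3. *)
Definition P2 : Type := {L : {vspace 'rV[K]_3} | \dim L == 1%N}.

(* Homogeneous coordinates of the point of affine coordinates [z] in the standard
   affine chart where the [k]-th homogeneous coordinate is nonzero: insert 1 at
   position [k]. *)
Definition chart (k : 'I_3) (z : 'rV[K]_2) : 'rV[K]_3 :=
  \row_i (if unlift k i is Some j then z 0 j else 1).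

(* A plane curve is given by a form [F] in three variables. *)
Implicit Types (F : mpoly.mpoly 3%N K) (P : P2).

Definition form_of_degree (d : nat) F : Prop :=
  F \is mpoly.ishomog1 d (mpoly.Measure.clone _ mpoly.mdeg _).

Definition eval_form F (v : 'rV[K]_3) : K := mpoly.meval (fun i => v 0 i) F.

Definition singular_point F P : Prop :=
  forall v : 'rV[K]_3, v \in val P ->
    eval_form F v = 0 /\ forall i : 'I_3, eval_form (mpoly.mderiv i F) v = 0.

Definition has_local_equation F (g : 'rV[K]_2 -> K) P : Prop :=
  exists (k : 'I_3) (z : 'rV[K]_2),
    val P = <[chart k z]>%VS /\
    analytically_equivalent (fun w => eval_form F (chart k w)) z g 0.

Definition ordinary_cusp F P : Prop := has_local_equation F (@cusp_equation K) P.
Definition ordinary_node F P : Prop := has_local_equation F (@node_equation K) P.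

Definition cuspidal F : Prop :=
  forall P, singular_point F P -> ordinary_cusp F P \/ ordinary_node F P.

End PlaneCurves.

(* Main.v *)
(* Let H be the Hessian of F, a form of degree 3(d - 2).  Since 3d(d - 2) has the
   parity of d and 8c + 6n is even, it suffices to prove 8c + 6n <= 3d(d - 2), which
   follows from Bezout for F and H: these forms meet with multiplicity at least 8 at
   a cusp and at least 6 at a node, and F does not divide H.

   Local multiplicities.  If all monomials of a form in x, y, z have weight at least
   N for weights p, q, 0, then those of its Hessian have weight at least
   3N - 2(p + q).  At a cusp, F has weight at least 6 for the weights 3, 2, so H has
   weight at least 8; at a node, F has weight at least 3 for the weights 1, 2 and
   for 2, 1, so the same holds for H.  Among the 12 monomials x^a y^b with
   3a + 2b < 10 the ideal (F, H) then spans at most 4 dimensions, and likewise among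
   the 10 monomials of degree < 4 at a node: the codimension is at least 8, resp. 6.
   These facts only involve the 2-jet of F at the singular point, which is read off
   from the first order expansions of the analytic change of coordinates.

   Bezout.  F is prime, so that (F, H) has codimension d * 3(d - 2) in large
   degrees, while jets at finitely many points can be prescribed independently by
   forms of large degree.

   F does not divide H.  The curve is infinite and has finitely many singular points,
   hence a smooth point.  Take it as origin with tangent y = 0: if F restricts to
   b x^m + ... on this line, with m >= 2 and b != 0, then H restricts to a form of
   order exactly m - 2, so F does not divide it.  Otherwise y divides F. *)

Require Import Defs.
From HB Require Import structures.
From Stdlib Require Import Classical.
From mathcomp Require Import all_boot all_order all_fingroup all_algebra.
From mathcomp Require Import ring lra zify.
From mathcomp Require mpoly.

Set Implicit Arguments.
Unset Strict Implicit.
Unset Printing Implicit Defensive.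

(* The notations of [mpoly], which clash with those of the analysis library, are
   confined to this module. *)
Module PlaneForms.
Import mpoly GRing.Theory.
Local Open Scope ring_scope.

(** * Unique factorization *)

Definition divides (A : idomainType) (a b : A) := exists c, b = a * c.

Definition prime_elt (A : idomainType) (a : A) : Prop :=
  [/\ a != 0, a \isn't a GRing.unit &
      forall b c : A, divides a (b * c) -> divides a b \/ divides a c].

(** Only the existence of prime factorizations is asked for: uniqueness follows from primality. *)
Definition factorial_domain (A : idomainType) : Prop :=
  forall a : A, a != 0 ->
    exists u (s : seq A),
      [/\ u \is a GRing.unit, forall p, p \in s -> prime_elt p &
          a = u * \prod_(p <- s) p].

Section Divisibility.
Variable A : idomainType.
Implicit Types a b c : A.

Lemma divides_mulr a b c : divides a b -> divides a (b * c).
Proof. by case=> d ->; exists (d * c); rewrite mulrA. Qed.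

Lemma divides_mull a b c : divides a b -> divides a (c * b).
Proof. by rewrite mulrC; apply: divides_mulr. Qed.

Lemma dividesD a b c : divides a b -> divides a c -> divides a (b + c).
Proof. by case=> x -> [y ->]; exists (x + y); rewrite mulrDr. Qed.

Lemma dividesN a b : divides a b -> divides a (- b).
Proof. by case=> x ->; exists (- x); rewrite mulrN. Qed.

Lemma prime_associate (u p : A) : u \is a GRing.unit -> prime_elt p -> prime_elt (u * p : A).
Proof.
move=> uU [p0 pN pP].
have toP x : divides (u * p) x -> divides p x.
  by case=> y ->; exists (u * y); rewrite mulrCA mulrA.
have ofP x : divides p x -> divides (u * p) x.
  by case=> y ->; exists (u^-1 * y); rewrite mulrACA divrr // mul1r.
split; first by rewrite mulf_neq0 //; apply: contraTneq uU => ->; rewrite unitr0.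
  by rewrite unitrM uU.
by move=> b c /toP/pP[] /ofP; [left | right].
Qed.

End Divisibility.

(** * Gauss's lemma *)

Section Poly.
Variable A : idomainType.
Implicit Types (p c : A) (f g h q : {poly A}).

Lemma divides_polyCP p q : divides p%:P q <-> forall i, divides p q`_i.
Proof.
split=> [[r ->] i|]; first by rewrite coefCM; exists r`_i.
elim/poly_ind: q => [_|q c IH dv]; first by exists 0; rewrite mulr0.
have [|r ->] := IH.
  by move=> i; have := dv i.+1; rewrite coefD coefMX coefC addr0.
have := dv 0%N; rewrite coefD coefMX coefC add0r => -[e ->].
by exists (r * 'X + e%:P); rewrite mulrDr mulrA polyCM.
Qed.

(** Both factors are peeled from their constant coefficients: [p] divides [a * b], say [a].
    Subtracting the multiple of [a] leaves [f * (g * 'X + b%:P) * 'X], where ['X] cancels and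
    induction applies. *)
Lemma prime_polyC p : prime_elt p -> prime_elt (p%:P : {poly A}).
Proof.
case=> p0 pN pP; split; first by rewrite polyC_eq0.
  by rewrite poly_unitE size_polyC p0 coefC.
have dvX q : divides p%:P (q * 'X) -> divides p%:P q.
  by move/divides_polyCP=> dv; apply/divides_polyCP=> i; have := dv i.+1; rewrite coefMX.
have dvB f g : divides p%:P f -> divides p%:P (g + f) -> divides p%:P g.
  by move=> d1 /dividesD/(_ (dividesN d1)); rewrite addrK.
elim/poly_ind=> [g _|f a IHf]; first by left; exists 0; rewrite mulr0.
elim/poly_ind=> [|g b IHg] dv; first by right; exists 0; rewrite mulr0.
have /pP [da|db] : divides p (a * b).
  move/divides_polyCP/(_ 0%N): (dv).
  by rewrite coef0M !coefD !coefMX !coefC !add0r.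
- have dA : divides p%:P a%:P by case: da => c ->; exists c%:P; rewrite polyCM.
  have /dvX/IHf[d1|] : divides p%:P (f * (g * 'X + b%:P) * 'X).
    rewrite mulrAC; apply: dvB (divides_mulr (g * 'X + b%:P) dA) _.
    by rewrite -mulrDl; exact: dv.
  + by left; apply: dividesD => //; apply: divides_mulr.
  + by right.
have dB : divides p%:P b%:P by case: db => c ->; exists c%:P; rewrite polyCM.
have /dvX/IHg[d1|d1] : divides p%:P ((f * 'X + a%:P) * g * 'X).
- rewrite -mulrA; apply: dvB (divides_mull (f * 'X + a%:P) dB) _.
  by rewrite -mulrDr; exact: dv.
- by left.
by right; apply: dividesD => //; apply: divides_mulr.
Qed.
End Poly.

Section GaussLemma.
Import Pdiv.WeakIdomain Pdiv.Idomain.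
Variable A : idomainType.
Hypothesis facA : factorial_domain A.
Implicit Types (p c : A) (f g h q : {poly A}).

(** The primes of [c] stay prime as constant polynomials, so each one can be moved in turn to
    whichever of [f] and [g] it divides. *)
Lemma split_constant_factor c q f g : c != 0 -> c *: q = f * g ->
  exists c1 c2 f' g', [/\ f = c1 *: f', g = c2 *: g' & q = f' * g'].
Proof.
move=> /facA[u [s [uU sP ->]]]; elim: s sP f g => [_ f g|p s IH sP f g].
  rewrite big_nil mulr1 => def.
  exists u, 1, (u^-1 *: f), g.
  by rewrite scalerA divrr // !scale1r -scalerAl -def scalerA mulVr ?scale1r.
have pP : prime_elt p by apply: sP; rewrite mem_head.
have {}IH := IH (fun x xs => sP x (@mem_behead _ (p :: s) x xs)).
have p0 : p%:P != 0 :> {poly A} by case: pP => p0 _ _; rewrite polyC_eq0.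
rewrite big_cons mulrCA -scalerA -mul_polyC => def.
have [_ _ pdv] := prime_polyC pP.
have [|[f1 def1]|[g1 def1]] := pdv f g.
- by rewrite -def; exists ((u * \prod_(j <- s) j) *: q).
- move: def; rewrite def1 -mulrA => /(mulfI p0)/IH[c1 [c2 [f' [g' [-> -> ->]]]]].
  by exists (p * c1), c2, f', g'; rewrite mul_polyC scalerA.
move: def; rewrite def1 mulrCA => /(mulfI p0)/IH[c1 [c2 [f' [g' [-> -> ->]]]]].
by exists c1, (p * c2), f', g'; rewrite mul_polyC scalerA.
Qed.

(** A nonconstant irreducible [f] has only unit constant factors: the part of [c] carried by [f] is
    invertible, and the rest is carried by the cofactor. *)
Lemma scale_divides_irreducible c f h : (1 < size f)%N -> irreducible_elt f ->
  c != 0 -> divides f (c *: h) -> divides f h.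
Proof.
move=> f1 [f0 _ fI] c0 [w /(split_constant_factor c0)[c1 [c2 [f' [w' [deff defw ->]]]]]].
have [|c1U|f'U] := fI c1%:P f'; first by rewrite mul_polyC.
  exists (c1%:P^-1 * w'); rewrite mulrA deff -mul_polyC; congr (_ * _).
  by rewrite mulrAC divrr // mul1r.
move: f1; rewrite deff; have: (size (c1 *: f') <= size f')%N := size_scale_leq _ _.
by move: f'U; rewrite poly_unitE => /andP[/eqP-> _] h1 /leq_trans/(_ h1).
Qed.

(** A constant is treated by its factorization in [A]. Otherwise [f] and [g] are compared over the
    fraction field: either they are coprime and [f] divides [h], or they have a nonconstant common
    factor, which must be [f] up to a constant. *)
Lemma irreducible_prime_poly f : irreducible_elt f -> prime_elt f.
Proof.
move=> fI; have [f0 fN fM] := fI.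
have [f1|f1] := leqP (size f) 1.
  have [c deff] : exists c, f = c%:P by exists f`_0; apply: size1_polyC.
  have c0 : c != 0 by move: f0; rewrite deff polyC_eq0.
  have [u [[|p s] [uU sP defc]]] := facA c0.
    have u0 : u != 0 by apply: contraTneq uU => ->; rewrite unitr0.
    by move: fN; rewrite deff defc big_nil mulr1 poly_unitE size_polyC coefC uU u0.
  have pP : prime_elt p by apply: sP; rewrite mem_head.
  rewrite big_cons in defc; set r := \prod_(j <- s) j in defc.
  have defp : f = (u * r)%:P * p%:P by rewrite deff defc -polyCM mulrAC mulrA.
  have [//|rU|pU] := fM (u * r)%:P p%:P.
    by rewrite defp; apply: prime_associate (prime_polyC pP).
  by case: (prime_polyC pP) => _; rewrite pU.
split=> // g h dv.
have [|ncop] := boolP (coprimep f g).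
  (* Over [A] the Bezout relation only holds up to nonzero constants; [f] divides [b *: h], and the
     constant is then removed. *)
  case/Bezout_coprimepP=> -[u v] /= /eqpP[[a b] /= /andP[a0 b0] eqab].
  right; apply: (scale_divides_irreducible f1 fI b0).
  have -> : b *: h = a *: (u * f + v * g) * h by rewrite eqab -scalerAl mul1r.
  rewrite -scalerAl -mul_polyC mulrDl; apply: divides_mull.
  apply: dividesD; first by rewrite mulrAC mulrC; exists (u * h); rewrite mulrC -mulrA.
  by rewrite -mulrA; apply: divides_mull.
(* Pseudo-division: the gcd divides [f] and [g] only after multiplication by nonzero constants [c]
   and [e]. *)
left; have /dvdpP[[c q] /= c0 deff] := dvdp_gcdl f g.
have /dvdpP[[e r] /= e0 defg] := dvdp_gcdr f g.
have [c1 [c2 [q' [D [_ defD fE]]]]] := split_constant_factor c0 deff.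
have D1 : (1 < size D)%N.
  have s1 : size (gcdp f g) != 1%N by [].
  have D0 : gcdp f g != 0 by rewrite gcdp_eq0 negb_and f0.
  have: (1 < size (gcdp f g))%N by rewrite ltn_neqAle eq_sym s1 size_poly_gt0.
  by move/leq_trans; apply; rewrite defD size_scale_leq.
apply: (scale_divides_irreducible f1 fI e0).
have [|q'U|DU] := fM q' D; first by [].
  exists (q'^-1 * (c2%:P * r)).
  have := mulrV q'U; set i := q'^-1 => qi.
  by rewrite defg defD fE -mul_polyC -[LHS]mul1r -qi; ring.
by move: DU; rewrite poly_unitE; case: eqP D1 => // ->.
Qed.
End GaussLemma.

(** * Separating the last variable *)

Section Mpoly.
Variables (n : nat) (K : fieldType).

Lemma muni_widen (q : {mpoly K[n]}) : muni (mwiden q) = q%:P.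
Proof.
elim/mpolyind: q => [|c m q _ _ IH]; first by rewrite !raddf0.
rewrite mwidenD mwidenZ mwidenX muniD IH polyCD; congr (_ + _).
rewrite muniZ -[in RHS]mul_mpolyC polyCM -mul_polyC; congr (_ * _).
rewrite muniE msuppX big_seq1 mcoeffX eqxx scale1r mnmwiden_ordmax expr0.
rewrite alg_polyC; congr ('X_[_])%:P.
by apply/mnmP=> i; rewrite mnmE mnmwiden_widen.
Qed.

Lemma muni_max : muni 'X_ord_max = 'X :> {poly {mpoly K[n]}}.
Proof.
rewrite muniE msuppX big_seq1 mcoeffX eqxx scale1r mnm1E eqxx expr1.
rewrite (_ : [multinom _ | _ < n] = 0%MM) ?mpolyX0 ?scale1r //.
by apply/mnmP=> i; rewrite mnmE mnm0E mnm1E -val_eqE /= gtn_eqF.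
Qed.

(** This gives the surjectivity of [muni]; with [muni_inj] it becomes a ring isomorphism onto
    polynomials in the last variable, along which primality is transferred. *)
Lemma mmultiK : cancel (@mmulti n K) (@muni n K).
Proof.
move=> p; rewrite /mmulti raddf_sum /= -[RHS]coefK poly_def.
by apply: eq_bigr=> i _; rewrite muniM muni_widen rmorphXn /= muni_max mul_polyC.
Qed.

Lemma muni_inj : injective (@muni n K).
Proof.
move=> p q /eqP; rewrite -subr_eq0 -muniB => /eqP p0; apply/eqP; rewrite -subr_eq0.
apply/eqP; move: (p - q) p0 => {q}p p0; apply/mpolyP=> m; rewrite mcoeff0.
have := congr1 (fun q : {poly {mpoly K[n]}} =>
  (q`_(m ord_max))@_[multinom m (widen_ord (leqnSn n) i) | i < n]) p0.
rewrite muniE coef_sum raddf_sum coef0 mcoeff0 /=.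
have [mp|/memN_msupp_eq0-> //] := boolP (m \in msupp p).
rewrite (bigD1_seq m) ?msupp_uniq //= !coefZ coefXn eqxx mulr1 mcoeffZ mcoeffX eqxx mulr1.
rewrite big1 ?addr0 // => m' m'm.
rewrite !coefZ coefXn; case: eqP => [emax|_]; last by rewrite mulr0 mcoeff0.
rewrite mulr1 mcoeffZ mcoeffX; case: eqP => [e|_]; last by rewrite mulr0.
case/eqP: m'm; apply/mnmP=> i; have [j ->|->] := unliftP ord_max i; last by [].
have -> : lift ord_max j = widen_ord (leqnSn n) j by apply/val_inj => /=; rewrite /bump leqNgt ltn_ord.
by move/mnmP/(_ j): e; rewrite !mnmE.
Qed.

End Mpoly.

Section Transfer.
Variables (A B : idomainType) (phi : {rmorphism A -> B}).
Hypotheses (phi_inj : injective phi) (phi_surj : forall b, exists a, phi a = b).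

Lemma iso_unit a : (phi a \is a GRing.unit) = (a \is a GRing.unit).
Proof.
apply/idP/idP=> [aU|]; last exact: rmorph_unit.
have [b defb] := phi_surj (phi a)^-1.
by apply/unitrP; exists b; split; apply: phi_inj; rewrite rmorphM rmorph1 defb ?mulVr ?mulrV.
Qed.

Lemma iso_irreducible a : irreducible_elt a -> irreducible_elt (phi a).
Proof.
case=> a0 aN aM; split; rewrite ?iso_unit //.
  by apply: contraNneq a0 => h; apply/eqP/phi_inj; rewrite rmorph0.
move=> b c; have [[b' <-] [c' <-]] := (phi_surj b, phi_surj c).
by rewrite -rmorphM !iso_unit => /phi_inj; apply: aM.
Qed.

Lemma iso_prime a : prime_elt (phi a) -> prime_elt a.
Proof.
case=> a0 aN aM; split; rewrite -?iso_unit //.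
  by apply: contraNneq a0 => ->; rewrite rmorph0.
have dv b : divides (phi a) (phi b) -> divides a b.
  by case=> c; case: (phi_surj c) => c' <-; rewrite -rmorphM => /phi_inj; exists c'.
move=> b c [e def]; have [|/dv|/dv] := aM (phi b) (phi c); [|by left|by right].
by rewrite -rmorphM def rmorphM; exists (phi e).
Qed.

End Transfer.

Section MpolyPrime.
Variable K : fieldType.

Lemma mpolyC_unit n (c : K) : c != 0 -> c%:MP_[n] \is a GRing.unit.
Proof.
by move=> c0; apply/unitrP; exists (c^-1)%:MP; rewrite -!mpolyCM mulVf ?mulfV.
Qed.

(** Induction on [msize]: when a nonunit splits into two nonunits, both factors are nonconstant,
    hence both are strictly smaller. *)
Lemma mpoly_prime_factorization n (f : {mpoly K[n]}) : f != 0 ->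
  (forall g : {mpoly K[n]}, irreducible_elt g -> prime_elt g) ->
  exists u (s : seq {mpoly K[n]}),
    [/\ u \is a GRing.unit, forall p, p \in s -> prime_elt p & f = u * \prod_(p <- s) p].
Proof.
move=> f0 irrP; have [k] := ubnP (msize f); elim: k f f0 => // k IH f f0 fk.
have [fU|fN] := boolP (f \is a GRing.unit).
  by exists f, [::]; split=> //; rewrite big_nil mulr1.
have [fI|fnI] := classic (irreducible_elt f).
  exists 1, [:: f]; rewrite unitr1 big_seq1 mul1r; split=> // p.
  by rewrite inE => /eqP->; apply: irrP.
have [g [h [deff gN hN]]] : exists g h, [/\ f = g * h, g \isn't a GRing.unit & h \isn't a GRing.unit].
  apply: NNPP => no; apply: fnI; split=> // b c def.
  have [|bN] := boolP (b \is a GRing.unit); first by left.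
  have [|cN] := boolP (c \is a GRing.unit); first by right.
  by case: no; exists b, c.
have [g0 h0] : g != 0 /\ h != 0.
  by move: f0; rewrite deff mulf_eq0 negb_or => /andP.
have szN (q : {mpoly K[n]}) : q != 0 -> q \isn't a GRing.unit -> (1 < msize q)%N.
  move=> q0; apply: contraR; rewrite -leqNgt => /msize1_polyC qE.
  rewrite qE; apply: mpolyC_unit.
  by move: q0; rewrite {1}qE mpolyC_eq0.
have eqs : msize f = (msize g + msize h).-1 by rewrite deff msizeM.
have sg := szN g g0 gN; have sh := szN h h0 hN.
have [| u [s [uU sP defg]]] := IH g g0; first by move: sg sh fk; rewrite eqs; lia.
have [| v [t [vU tP defh]]] := IH h h0; first by move: sg sh fk; rewrite eqs; lia.
rewrite deff defg defh; exists (u * v), (s ++ t); rewrite unitrM uU vU big_cat /=; split=> //; last by ring.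
by move=> p; rewrite mem_cat => /orP[/sP|/tP].
Qed.

(** Induction on the number of variables: by induction the ring in [n] variables is factorial, so
    Gauss's lemma applies to polynomials in the last variable over it. *)
Theorem irreducible_prime_mpoly n (f : {mpoly K[n]}) :
  irreducible_elt f -> prime_elt f.
Proof.
elim: n f => [|n IH] f fI.
  case: fI => f0 /negP[]; rewrite [f]nvar0_mpolyC; apply: mpolyC_unit.
  by move: f0; rewrite [f]nvar0_mpolyC mpolyC_eq0 mcoeffC eqxx mulr1.
have surj (b : {poly {mpoly K[n]}}) : exists a, muni a = b.
  by exists (mmulti b); rewrite mmultiK.
pose phi : {rmorphism {mpoly K[n.+1]} -> {poly {mpoly K[n]}}} := @muni n K.
have phi_inj : injective phi by apply: muni_inj.
have phi_surj b : exists a, phi a = b by apply: surj.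
apply: (iso_prime phi_inj phi_surj).
apply: irreducible_prime_poly; last exact: (iso_irreducible phi_inj phi_surj).
by move=> g g0; apply: mpoly_prime_factorization.
Qed.

End MpolyPrime.

(** * Linear changes of coordinates, Hessians and weights *)

Section AlgInd.
Variables (n : nat) (K : comNzRingType).

Lemma mpoly_alg_ind (P : {mpoly K[n]} -> Prop) :
  (forall c, P c%:MP) -> (forall i, P 'X_i) ->
  (forall p q, P p -> P q -> P (p + q)) -> (forall p q, P p -> P q -> P (p * q)) ->
  forall p, P p.
Proof.
move=> PC PX PD PM p; elim/mpolyind: p => [|c m p _ _ Pp]; first by rewrite -mpolyC0.
apply: PD => //; rewrite -mul_mpolyC; apply: (PM) => //.
rewrite mpolyXE_id; apply: big_ind => [|p' q'|i _]; [by rewrite -mpolyC1|exact: (PM)|].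
elim: (m i) => [|k IH]; first by rewrite expr0 -mpolyC1.
by rewrite exprS; apply: PM.
Qed.

End AlgInd.

Section LinearChange.
Variables (n : nat) (K : comNzRingType).
Implicit Types (A B : 'M[K]_n) (p q : {mpoly K[n]}).

Definition linear_forms A : n.-tuple {mpoly K[n]} :=
  [tuple \sum_(j < n) A i j *: 'X_j | i < n].

(** The pull-back [v |-> p (A v)]; it therefore reverses the order of composition. *)
Definition linear_change A p : {mpoly K[n]} := p \mPo linear_forms A.

HB.instance Definition _ A := GRing.LRMorphism.copy (linear_change A) (comp_mpoly (linear_forms A)).

Lemma linear_changeD A : {morph linear_change A : p q / p + q}.
Proof. exact: rmorphD. Qed.

Lemma linear_changeM A : {morph linear_change A : p q / p * q}.
Proof. exact: rmorphM. Qed.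

Lemma linear_changeZ A c p : linear_change A (c *: p) = c *: linear_change A p.
Proof. exact: linearZ. Qed.

Lemma linear_changeB A : {morph linear_change A : p q / p - q}.
Proof. exact: rmorphB. Qed.

Lemma linear_change_sum A (I : Type) (r : seq I) (P : pred I) (F : I -> {mpoly K[n]}) :
  linear_change A (\sum_(i <- r | P i) F i) = \sum_(i <- r | P i) linear_change A (F i).
Proof. exact: linear_sum. Qed.

Lemma linear_changeX A i : linear_change A 'X_i = \sum_(j < n) A i j *: 'X_j.
Proof. by rewrite /linear_change comp_mpolyXU -tnth_nth tnth_mktuple. Qed.

Lemma linear_changeC A c : linear_change A c%:MP = c%:MP.
Proof. exact: comp_mpolyC. Qed.

Lemma linear_change_comp A B p :
  linear_change B (linear_change A p) = linear_change (A *m B) p.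
Proof.
elim/mpoly_alg_ind: p => [c|i|p q IHp IHq|p q IHp IHq].
- by rewrite !linear_changeC.
- rewrite !linear_changeX linear_change_sum.
  transitivity (\sum_(j < n) \sum_(k < n) (A i j * B j k) *: 'X_k : {mpoly K[n]}).
    apply: eq_bigr => j _; rewrite linear_changeZ linear_changeX scaler_sumr.
    by apply: eq_bigr => k _; rewrite scalerA.
  by rewrite exchange_big; apply: eq_bigr => k _; rewrite mxE scaler_suml.
- by rewrite !linear_changeD IHp IHq.
- by rewrite !linear_changeM IHp IHq.
Qed.

Lemma linear_change1 p : linear_change 1%:M p = p.
Proof.
elim/mpoly_alg_ind: p => [c|i|p q IHp IHq|p q IHp IHq].
- by rewrite !linear_changeC.
- rewrite linear_changeX (bigD1 i) //= mxE eqxx scale1r big1 ?addr0 // => j ji.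
  by rewrite mxE eq_sym (negPf ji) scale0r.
- by rewrite !linear_changeD IHp IHq.
- by rewrite !linear_changeM IHp IHq.
Qed.

Lemma meval_linear_change A p (v : 'I_n -> K) :
  (linear_change A p).@[v] = p.@[fun i => \sum_(j < n) A i j * v j].
Proof.
rewrite comp_mpoly_meval; apply: meval_eq => i; rewrite tnth_mktuple linear_sum /=.
by apply: eq_bigr => j _; rewrite mevalZ mevalXU.
Qed.

Lemma linear_change_homog A d p :
  p \is d.-homog -> linear_change A p \is d.-homog.
Proof.
move=> /dhomogP hp; rewrite [p]mpolyE linear_change_sum big_seq.
apply: rpred_sum => m /hp <-; rewrite linearZ /=; apply: rpredZ.
rewrite /linear_change comp_mpolyX /= mdegE; elim/big_ind2: _ => [|? ? ? ?|i _]; [exact: dhomog1|exact: dhomogM|].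
suff /(dhomogMn (m i)) : tnth (linear_forms A) i \is 1.-homog by rewrite mul1n.
by rewrite tnth_mktuple; apply: rpred_sum => j _; apply: rpredZ; rewrite dhomogX /= mdeg1.
Qed.

Lemma mderivU i j : mderiv i ('X_j : {mpoly K[n]}) = (i == j)%:R.
Proof.
rewrite mderivX mnm1E eq_sym; case: eqP => [->|_]; last by rewrite scale0r.
rewrite (_ : (U_(j) - U_(j))%MM = 0%MM) ?mpolyX0 ?scale1r //.
by apply/mnmP=> k; rewrite mnmBE subnn mnm0E.
Qed.

Lemma mderiv_linear_change A p j :
  mderiv j (linear_change A p) = \sum_(i < n) A i j *: linear_change A (mderiv i p).
Proof.
elim/mpoly_alg_ind: p => [c|i|p q IHp IHq|p q IHp IHq].
- rewrite linear_changeC mderivC big1 // => i _.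
  by rewrite mderivC linear0 scaler0.
- rewrite linear_changeX linear_sum (bigD1 j) //= [in RHS](bigD1 i) //=.
  rewrite mderivZ !mderivU !eqxx !big1 => [|k ki|k kj].
  + by rewrite -mpolyC1 linear_changeC.
  + by rewrite mderivU (negPf ki) mulr0n -mpolyC0 linear_changeC mpolyC0 scaler0.
  + by rewrite mderivZ mderivU eq_sym (negPf kj) scaler0.
- rewrite linear_changeD mderivD IHp IHq -big_split; apply: eq_bigr => i _ /=.
  by rewrite mderivD linear_changeD scalerDr.
- rewrite linear_changeM mderivM IHp IHq mulr_suml mulr_sumr -big_split; apply: eq_bigr => i _ /=.
  by rewrite mderivM linear_changeD !linear_changeM scalerDr scalerAl scalerAr.
Qed.

Definition hessian_matrix p : 'M[{mpoly K[n]}]_n := \matrix_(i, j) mderiv i (mderiv j p).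

Definition hessian p : {mpoly K[n]} := \det (hessian_matrix p).

Lemma hessian_matrix_linear_change A p :
  hessian_matrix (linear_change A p) =
    map_mx (@mpolyC n K) A^T *m map_mx (linear_change A) (hessian_matrix p)
      *m map_mx (@mpolyC n K) A.
Proof.
apply/matrixP=> i j; rewrite !mxE mderiv_linear_change linear_sum /=.
apply: eq_bigr => k _; rewrite mderivZ mderiv_linear_change !mxE scaler_sumr mulr_suml.
by apply: eq_bigr => l _; rewrite !mxE scalerA -mul_mpolyC mpolyCM; ring.
Qed.

Lemma hessian_linear_change A p :
  hessian (linear_change A p) = (\det A) ^+ 2 *: linear_change A (hessian p).
Proof.
have e1 : \det (map_mx (@mpolyC n K) A) = (\det A)%:MP by apply: det_map_mx.
have e2 : \det (map_mx (linear_change A) (hessian_matrix p)) = linear_change A (hessian p).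
  by apply: det_map_mx.
rewrite /hessian hessian_matrix_linear_change !det_mulmx -matrix.map_trmx det_tr e1 e2.
by rewrite -mul_mpolyC rmorphXn /=; ring.
Qed.

Lemma mderiv_homog d p i : p \is d.-homog -> mderiv i p \is d.-1.-homog.
Proof.
move=> /dhomogP hp; apply/dhomogP => m; rewrite mcoeff_msupp mcoeff_deriv => nz.
have /hp : (m + U_(i))%MM \in msupp p.
  by rewrite mcoeff_msupp; apply: contraNneq nz => ->; rewrite mul0rn.
by rewrite /= mdegD mdeg1 addn1 => <-.
Qed.

Lemma hessian_homog d p : p \is d.-homog -> hessian p \is (n * (d - 2)).-homog.
Proof.
move=> hp; rewrite /hessian /determinant; apply: rpred_sum => s _.
rewrite -signr_odd mulr_sign; suff h : \prod_i hessian_matrix p i (s i) \is (n * (d - 2)).-homog.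
  by case: ifP => // _; rewrite rpredN.
rewrite -[X in (X * _)%N]card_ord -sum_nat_const; elim/big_ind2: _ => [|? ? ? ?|i _]; [exact: dhomog1|exact: dhomogM|].
by rewrite mxE subn2; apply: mderiv_homog; apply: mderiv_homog.
Qed.

End LinearChange.

Section Euler.
Variables (n : nat) (K : comNzRingType).

Lemma euler_homog d (p : {mpoly K[n]}) : p \is d.-homog ->
  \sum_(i < n) 'X_i * mderiv i p = p *+ d.
Proof.
move=> /dhomogP hp; rewrite {1 2}[p]mpolyE -sumrMnl.
under eq_bigr => i _ do rewrite linear_sum mulr_sumr.
rewrite exchange_big /=; apply: eq_big_seq => m /hp /= <-.
rewrite mdegE -sumrMnr; apply: eq_bigr => i _.
rewrite mderivZ mderivX -scalerAr -scalerAr -mpolyXD scaler_nat.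
have [mi|mi] := eqVneq (m i) 0; first by rewrite mi !mulr0n scaler0.
by rewrite addmC submK ?lep1mP // scalerMnr.
Qed.
End Euler.

(** * Weighted orders of vanishing *)

Section Weights.
Variables (n : nat) (K : comNzRingType).
Implicit Types (w : 'I_n -> nat) (p q : {mpoly K[n]}).

Definition weight w (m : 'X_{1..n}) : nat := \sum_(i < n) w i * m i.

(** Membership in a step of the weight filtration rather than an exact order: the zero polynomial
    lies in all steps. *)
Definition weight_ge w N p : Prop := forall m, (weight w m < N)%N -> p@_m = 0.

Lemma weightD w m m' : weight w (m + m')%MM = (weight w m + weight w m')%N.
Proof. by rewrite -big_split; apply: eq_bigr => i _; rewrite mnmDE mulnDr. Qed.

Lemma weightU w i : weight w U_(i)%MM = w i.
Proof.
rewrite /weight (bigD1 i) //= mnm1E eqxx muln1 big1 ?addn0 // => j ji.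
by rewrite mnm1E eq_sym (negPf ji) muln0.
Qed.

Lemma weight_geW w N N' p : (N' <= N)%N -> weight_ge w N p -> weight_ge w N' p.
Proof. by move=> le h m lt; apply: h; apply: leq_trans le. Qed.

Lemma weight_ge_0 w N : weight_ge w N 0.
Proof. by move=> m _; rewrite mcoeff0. Qed.

Lemma weight_geD w N p q : weight_ge w N p -> weight_ge w N q -> weight_ge w N (p + q).
Proof. by move=> hp hq m lt; rewrite mcoeffD hp ?hq ?addr0. Qed.

Lemma weight_geN w N p : weight_ge w N p -> weight_ge w N (- p).
Proof. by move=> hp m lt; rewrite mcoeffN hp ?oppr0. Qed.

Lemma weight_geZ w N c p : weight_ge w N p -> weight_ge w N (c *: p).
Proof. by move=> hp m lt; rewrite mcoeffZ hp ?mulr0. Qed.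

Lemma weight_geX w m : weight_ge w (weight w m) ('X_[m] : {mpoly K[n]}).
Proof. by move=> m'; rewrite mcoeffX; case: eqP => // ->; rewrite ltnn. Qed.

Lemma weight_geM w N N' p q :
  weight_ge w N p -> weight_ge w N' q -> weight_ge w (N + N') (p * q).
Proof.
move=> hp hq m lt; rewrite mcoeffM big1 // => -[m1 m2] /= /eqP em.
have [lt1|le1] := ltnP (weight w m1) N; first by rewrite hp ?mul0r.
have ew : weight w m = (weight w m1 + weight w m2)%N by rewrite {1}em weightD.
by rewrite hq ?mulr0 //; move: lt le1; rewrite ew; lia.
Qed.

Lemma weight_ge_sum w N (I : Type) (r : seq I) (P : pred I) (G : I -> {mpoly K[n]}) :
  (forall i, P i -> weight_ge w N (G i)) -> weight_ge w N (\sum_(i <- r | P i) G i).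
Proof.
move=> h; apply: big_ind => //; [exact: weight_ge_0|by move=> *; apply: weight_geD].
Qed.

Lemma weight_ge_prod w (I : Type) (r : seq I) (P : pred I) (N : I -> nat)
    (G : I -> {mpoly K[n]}) : (forall i, P i -> weight_ge w (N i) (G i)) ->
  weight_ge w (\sum_(i <- r | P i) N i) (\prod_(i <- r | P i) G i).
Proof.
by move=> h; elim/big_rec2: _ => // i a b Pi; apply: weight_geM; apply: h.
Qed.

Lemma weight_ge_exp w N p k : weight_ge w N p -> weight_ge w (k * N) (p ^+ k).
Proof.
move=> h; elim: k => [|k IH]; first by rewrite mul0n.
by rewrite exprS mulSn; apply: weight_geM.
Qed.

Lemma weight_ge_mderiv w N p i : weight_ge w N p -> weight_ge w (N - w i) (mderiv i p).
Proof.
move=> h m lt; rewrite mcoeff_deriv h ?mul0rn // weightD weightU.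
by move: lt; lia.
Qed.

(** In each term of the Leibniz formula every variable is differentiated exactly twice, once as a
    row index and once as a column index, which costs twice the sum of the weights. *)
Lemma weight_ge_hessian w N p : weight_ge w N p ->
  weight_ge w (n * N - 2 * \sum_(i < n) w i) (hessian p).
Proof.
move=> h; rewrite /hessian /determinant; apply: weight_ge_sum => s _.
rewrite -signr_odd mulr_sign.
suff hs : weight_ge w (n * N - 2 * \sum_(i < n) w i) (\prod_i hessian_matrix p i (s i)).
  by case: ifP => // _; apply: weight_geN.
(* Each truncated difference is at least the true one, so their sum dominates the announced
   bound. *)
apply: (@weight_geW _ (\sum_(i < n) (N - w (s i) - w i))); last first.
  by apply: weight_ge_prod => i _; rewrite mxE; do 2!apply: weight_ge_mderiv.
have es : (\sum_(i < n) w (s i) = \sum_(i < n) w i)%N.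
  by rewrite [RHS](reindex_inj (@perm_inj _ s)).
have : (\sum_(i < n) N <= \sum_(i < n) (N - w (s i) - w i) + \sum_(i < n) w (s i) + \sum_(i < n) w i)%N.
  by rewrite -!big_split; apply: leq_sum => i _ /=; lia.
by rewrite sum_nat_const card_ord es; lia.
Qed.

End Weights.

(** * The Hessian does not vanish identically on the curve *)

Import Num.Theory.

Definition ix : 'I_3 := @Ordinal 3 0 isT.
Definition iy : 'I_3 := @Ordinal 3 1 isT.
Definition iz : 'I_3 := @Ordinal 3 2 isT.

Lemma ord3P (P : 'I_3 -> Prop) : P ix -> P iy -> P iz -> forall i, P i.
Proof.
move=> hx hy hz [[|[|[|//]]] lt].
- by have -> : Ordinal lt = ix by apply: ord_inj.
- by have -> : Ordinal lt = iy by apply: ord_inj.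
- by have -> : Ordinal lt = iz by apply: ord_inj.
Qed.

Lemma sum3 (V : nmodType) (F : 'I_3 -> V) :
  \sum_(i < 3) F i = F ix + F iy + F iz.
Proof.
rewrite !big_ord_recr big_ord0 /= add0r.
by congr (F _ + F _ + F _); apply: ord_inj.
Qed.

Lemma sumn3 (F : 'I_3 -> nat) : (\sum_(i < 3) F i = F ix + F iy + F iz)%N.
Proof.
rewrite !big_ord_recr big_ord0 /= add0n.
by congr (F _ + F _ + F _)%N; apply: ord_inj.
Qed.

Lemma prod3 (R : pzSemiRingType) (F : 'I_3 -> R) :
  \prod_(i < 3) F i = F ix * F iy * F iz.
Proof.
rewrite !big_ord_recr big_ord0 /= mul1r.
by congr (F _ * F _ * F _); apply: ord_inj.
Qed.

Lemma det3 (R : comNzRingType) (M : 'M[R]_3) :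
  \det M = M ix ix * (M iy iy * M iz iz - M iy iz * M iz iy)
         - M ix iy * (M iy ix * M iz iz - M iy iz * M iz ix)
         + M ix iz * (M iy ix * M iz iy - M iy iy * M iz ix).
Proof.
have det2 (N : 'M[R]_2) : \det N = N ord0 ord0 * N ord_max ord_max - N ord0 ord_max * N ord_max ord0.
  rewrite (expand_det_row _ ord0) !big_ord_recl big_ord0 addr0 /cofactor !det_mx11 !mxE /=.
  rewrite expr0 expr1 mul1r mulN1r mulrN.
  by congr (N _ _ * N _ _ - N _ _ * N _ _); apply: ord_inj.
rewrite (expand_det_row _ ix) sum3 /cofactor !det2 !mxE /=.
have l00 : lift ix ord0 = iy :> 'I_3 by apply: ord_inj.
have l01 : lift ix ord_max = iz :> 'I_3 by apply: ord_inj.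
have l10 : lift iy ord0 = ix :> 'I_3 by apply: ord_inj.
have l11 : lift iy ord_max = iz :> 'I_3 by apply: ord_inj.
have l20 : lift iz ord0 = ix :> 'I_3 by apply: ord_inj.
have l21 : lift iz ord_max = iy :> 'I_3 by apply: ord_inj.
by rewrite l00 l01 l10 l11 l20 l21; ring.
Qed.

Section RestrictionToLine.
Variable K : numFieldType.
Implicit Types (p F G : {mpoly K[3]}).

(* The line y = 0, in the affine coordinate z = 1. *)
Definition line_point (i : 'I_3) : {poly K} :=
  if i == ix then 'X else if i == iy then 0 else 1.

Definition on_line p : {poly K} := mmap polyC line_point p.

Lemma on_lineD p q : on_line (p + q) = on_line p + on_line q.
Proof. exact: rmorphD. Qed.

Lemma on_lineM p q : on_line (p * q) = on_line p * on_line q.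
Proof. exact: rmorphM. Qed.

Lemma on_lineN p : on_line (- p) = - on_line p.
Proof. exact: rmorphN. Qed.

Lemma on_lineC c : on_line c%:MP = c%:P.
Proof. exact: mmapC. Qed.

Lemma on_lineX i : on_line 'X_i = line_point i.
Proof. by rewrite /on_line mmapX mmap1U. Qed.

Lemma on_line_mderiv p : on_line (mderiv ix p) = (on_line p)^`().
Proof.
elim/mpoly_alg_ind: p => [c|i|p q IHp IHq|p q IHp IHq].
- by rewrite mderivC (on_lineC c) derivC -mpolyC0 on_lineC.
- rewrite mderivU on_lineX /line_point eq_sym; case: eqP => _.
    by rewrite derivX -mpolyC1 on_lineC.
  rewrite -[(false%:R : {mpoly K[3]})]mpolyC0 on_lineC polyC0.
  by case: eqP => _; rewrite -?[1 in RHS]polyC1 ?derivC ?deriv0.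
- by rewrite mderivD !on_lineD derivD IHp IHq.
- by rewrite mderivM on_lineD !on_lineM derivM IHp IHq.
Qed.

(** Euler's relation on y = 0, z = 1, which eliminates the derivatives in z. *)
Lemma on_line_euler d p : p \is d.-homog ->
  'X * on_line (mderiv ix p) + on_line (mderiv iz p) = on_line p *+ d.
Proof.
move=> /euler_homog/(congr1 on_line); rewrite sum3 !on_lineD !on_lineM !on_lineX /=.
rewrite /line_point /= mul0r addr0 mul1r => ->.
by rewrite /on_line raddfMn.
Qed.

Lemma horner_on_line p c : (on_line p).[c] = p.@[fun i => (line_point i).[c]].
Proof.
elim/mpoly_alg_ind: p => [a|i|p q IHp IHq|p q IHp IHq].
- by rewrite on_lineC hornerC mevalC.
- by rewrite on_lineX mevalXU.
- by rewrite on_lineD hornerD mevalD IHp IHq.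
- by rewrite on_lineM hornerM mevalM IHp IHq.
Qed.

(* If G = b x^m + ... on the tangent line y = 0, with m >= 2 and b != 0, then the
   Hessian vanishes there to order exactly m - 2, so G cannot divide it. *)
Lemma flex_line d G : G \is d.+2.-homog ->
  (on_line G).[0] = 0 -> (on_line (mderiv ix G)).[0] = 0 ->
  (on_line (mderiv iy G)).[0] != 0 -> divides G (hessian G) -> on_line G = 0.
Proof.
move=> hG G0 Gx0 Gy0 [R defR]; apply/eqP; apply/negPn/negP => g0.
have hx : mderiv ix G \is d.+1.-homog by exact: mderiv_homog hG.
have hy : mderiv iy G \is d.+1.-homog by exact: mderiv_homog hG.
have hz : mderiv iz G \is d.+1.-homog by exact: mderiv_homog hG.
have e1 := on_line_euler hG; have e2 := on_line_euler hx.
have e3 := on_line_euler hy; have e4 := on_line_euler hz.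
have defH : on_line (hessian G) = on_line G * on_line R by rewrite defR on_lineM.
move: defH; rewrite /hessian det3 !mxE.
rewrite ?(mderiv_comm iy ix) ?(mderiv_comm iz ix) ?(mderiv_comm iz iy) in e2 e3 e4 *.
have ea : on_line (mderiv ix (mderiv ix G)) = (on_line G)^`()^`() by rewrite !on_line_mderiv.
have ex : on_line (mderiv ix G) = (on_line G)^`() by rewrite on_line_mderiv.
rewrite ea ex in e1 e2 Gx0.
rewrite !(on_lineD, on_lineN, on_lineM) ea.
move: e1 e2 e3 e4 Gx0 Gy0 G0 g0; move: (on_line G) (on_line R) => g r.
move: (on_line (mderiv iy G)) (on_line (mderiv iz G)) => gy gz.
move: (on_line (mderiv iy (mderiv ix G))) (on_line (mderiv iz (mderiv ix G))) => b c.
move: (on_line (mderiv iy (mderiv iy G))) (on_line (mderiv iz (mderiv iy G))) => e f.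
move: (on_line (mderiv iz (mderiv iz G))) => h e1 e2 e3 e4 Gx0 Gy0 G0 g0 eqH.
have [m [q]] := multiplicity_XsubC g 0; rewrite g0 /= subr0 => q0 defg.
(* Euler's relations for G and its first derivatives. In particular [f], the restriction of G_yz,
   takes the nonzero value [gy.[0] *+ d.+1] at the origin. *)
have ef : f = gy *+ d.+1 - 'X * b by rewrite -e3; ring.
have eh : h = gz *+ d.+1 - 'X * c by rewrite -e4; ring.
have ec : c = g^`() *+ d.+1 - 'X * (g^`())^`() by rewrite -e2; ring.
have ez : gz = g *+ d.+2 - 'X * g^`() by rewrite -e1; ring.
have derX k (u : {poly K}) : (u * 'X^(k.+1))^`() = (u^`() * 'X + u *+ k.+1) * 'X^k.
  by rewrite derivM derivXn exprS; ring.
(* Orders 0 and 1 are excluded by the vanishing of [g] and its derivative at 0; from here on the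
   order is [m.+2]. *)
case: m => [|[|m]] in defg.
- by move: q0; rewrite rootE; move/eqP: G0; rewrite defg expr0 mulr1 => ->.
- move: q0; rewrite rootE; move/eqP: Gx0; rewrite defg derX expr0 mulr1 mulr1n.
  by rewrite hornerD hornerMX mulr0 add0r => ->.
move: ez ec eqH; rewrite defg !derX; set q1 := _ + q *+ _; set q2 := _ + q1 *+ _ => ez ec.
pose c' := q1 *+ d.+1 - q2; pose h' := 'X * (q *+ d.+2 - q1) *+ d.+1 - 'X * c'.
have {}ec : c = c' * 'X^(m.+1) by rewrite ec /c' exprS; ring.
have {}eh : h = h' * 'X^(m.+1) by rewrite eh ez ec /h' exprS exprS; ring.
move=> eqH.
have Xm : 'X^m != 0 :> {poly K} by rewrite monic_neq0 ?monicXn.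
(* All terms of the equation other than the product of G_xx and the square of G_yz are divisible by
   ['X^(m.+1)]. Cancelling ['X^m] and evaluating at 0 leaves [q2.[0] * f.[0] ^+ 2 = 0], where both
   factors are nonzero. *)
have /(mulIf Xm)/(congr1 (fun u : {poly K} => u.[0])) : (q2 * f * f) * 'X^m =
    ('X * (q2 * e * h' * 'X^m - b * (b * h' - f * c')
      + c' * (b * f - e * c) - 'X * q * r)) * 'X^m.
  move: eqH; rewrite eh ec !exprS => eqH.
  by rewrite -[LHS]add0r -[0](subrr (q * ('X * ('X * 'X^m)) * r)) -{1}eqH; ring.
rewrite [in RHS]hornerM hornerX mul0r !hornerM => /eqP; rewrite -mulrA mulf_eq0 mulf_eq0 orbb.
have -> : f.[0] == 0 = false.
  by rewrite ef hornerD hornerN hornerM hornerX mul0r subr0 hornerMn mulrn_eq0 (negPf Gy0).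
have q10 : q1.[0] = q.[0] *+ m.+2.
  by rewrite /q1 hornerD hornerM hornerX mulr0 add0r hornerMn.
have -> : q2.[0] = q.[0] *+ (m.+2 * m.+1).
  by rewrite /q2 hornerD hornerM hornerX mulr0 add0r hornerMn q10 -mulrnA.
by rewrite orbF mulrn_eq0 /= -/(root q 0) (negPf q0).
Qed.

End RestrictionToLine.

(** * Coordinates adapted to a point *)

Section Coordinates.
Variable K : numFieldType.
Implicit Types (F G : {mpoly K[3]}) (A : 'M[K]_3) (v : 'I_3 -> K).

(** The point (0 : 0 : 1). A matrix [A] carries it to its last column, so an invertible [A] also
    encodes a point together with local coordinates around it. *)
Definition ez_point (i : 'I_3) : K := (i == iz)%:R.

Lemma meval_linear_change_ez A F :
  (linear_change A F).@[ez_point] = F.@[fun i => A i iz].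
Proof.
rewrite meval_linear_change; apply: meval_eq => i.
by rewrite sum3 /ez_point /= !mulr0 !add0r mulr1.
Qed.

Lemma linear_change_unit A F : A \in unitmx ->
  linear_change (invmx A) (linear_change A F) = F.
Proof. by move=> AU; rewrite linear_change_comp mulmxV // linear_change1. Qed.

Lemma linear_change_unitV A F : A \in unitmx ->
  linear_change A (linear_change (invmx A) F) = F.
Proof. by move=> AU; rewrite linear_change_comp mulVmx // linear_change1. Qed.

Lemma linear_change_irreducible A F : A \in unitmx ->
  irreducible_elt F -> irreducible_elt (linear_change A F).
Proof.
move=> AU; apply: (iso_irreducible (phi := linear_change A)).
  by move=> p q /(congr1 (linear_change (invmx A))); rewrite !linear_change_unit.
by move=> p; exists (linear_change (invmx A) p); apply: linear_change_unitV.
Qed.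

Lemma complete_to_basis v : (exists i, v i != 0) ->
  exists2 A, A \in unitmx & forall i, A i iz = v i.
Proof.
case=> i0 vi0; pose r : 'rV[K]_3 := \row_i v i.
have r0 : r != 0 by apply: contraNneq vi0 => /rowP/(_ i0); rewrite !mxE => ->.
have defr := mulmx_ebase r; have rk : \rank r = 1%N by rewrite rank_rV r0.
set U := row_ebase r in defr; set c := col_ebase r in defr.
have c0 : c 0 0 != 0.
  by have := col_ebase_unit r; rewrite unitmxE det_mx11 unitfE.
(* As [r] has rank one, it is [c 0 0] times the first row of [U]; the row exchange and the
   transposition make it the last column. *)
exists (xrow ix iz (c 0 0 *: U))^T => [|i].
  rewrite unitmx_tr xrowE unitmx_mul unitmx_perm /= unitmxZ ?unitfE //.
  exact: row_ebase_unit.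
rewrite !mxE tpermR.
have -> : v i = r 0 i by rewrite mxE.
rewrite -[in RHS]defr [c]mx11_scalar mul_scalar_mx -scalemxAl !mxE; congr (_ * _).
rewrite (bigD1 ix) //= big1 ?addr0 => [|j jx]; first by rewrite mxE rk /= mul1r.
by rewrite mxE eq_sym -val_eqE /= in jx *; rewrite (negPf jx) mul0r.
Qed.

(** By homogeneity, monomials without y are told apart by their exponent in x, so the restriction to
    y = 0, z = 1 still shows each of their coefficients. *)
Lemma divides_y d G : G \is d.-homog -> on_line G = 0 -> divides 'X_iy G.
Proof.
move=> /dhomogP hG G0.
have cG (m : 'X_{1..3}) : m iy = 0%N -> G@_m = 0.
  move=> my; have [mG|/memN_msupp_eq0//] := boolP (m \in msupp G).
  have := congr1 (fun p : {poly K} => p`_(m ix)) G0; rewrite coef0 /on_line /mmap.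
  have mm (m' : 'X_{1..3}) : mmap1 (line_point K) m' = ((m' iy == 0%N)%:R *: 'X^(m' ix)) :> {poly K}.
    rewrite /mmap1 prod3 /line_point /= expr1n mulr1 expr0n.
    by case: (m' iy == 0%N); rewrite ?mulr0 ?mulr1 ?scale1r ?scale0r.
  rewrite coef_sum (bigD1_seq m) ?msupp_uniq //= mm my eqxx scale1r coefCM coefXn eqxx mulr1.
  rewrite big1_seq ?addr0 // => m' /andP[m'm m'G].
  rewrite mm; case: eqP => [m'y|_]; last by rewrite scale0r mulr0 coef0.
  rewrite scale1r coefCM coefXn; case: eqP => [ex|_]; last by rewrite mulr0.
  case/eqP: m'm; apply/mnmP; apply: ord3P; rewrite ?my ?m'y //.
  have := hG _ m'G; have := hG _ mG; rewrite /= !mdegE !sumn3 my m'y ex => <-.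
  by move/addnI.
exists (\sum_(m <- msupp G) G@_m *: 'X_[m - U_(iy)]).
rewrite mulr_sumr [LHS]mpolyE; apply: eq_bigr => m _; rewrite -scalerAr -mpolyXD.
have [/cG->|my] := eqVneq (m iy) 0%N; first by rewrite !scale0r.
by rewrite addmC submK ?lep1mP.
Qed.

Lemma mderiv_iz_ez d G : G \is d.+1.-homog -> G.@[ez_point] = 0 -> (mderiv iz G).@[ez_point] = 0.
Proof.
move=> /euler_homog/(congr1 (meval ez_point)); rewrite sum3 !mevalD !mevalM !mevalXU.
by rewrite /ez_point /= !mul0r !add0r mul1r raddfMn /= => -> ->; rewrite mul0rn.
Qed.

End Coordinates.

Section SmoothPoint.
Variable K : numFieldType.
Implicit Types (F G : {mpoly K[3]}) (A : 'M[K]_3) (v : 'I_3 -> K).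

(** A change of x and y fixing (0 : 0 : 1) turns the tangent line into y = 0. *)
Lemma tangent_coordinates G : (mderiv iz G).@[ez_point K] = 0 ->
  (exists i, (mderiv i G).@[ez_point K] != 0) ->
  exists2 B, B \in unitmx & [/\ forall i, B i iz = ez_point K i,
    (mderiv ix (linear_change B G)).@[ez_point K] = 0 &
    (mderiv iy (linear_change B G)).@[ez_point K] != 0].
Proof.
move=> gz [i gi].
have dB (B : 'M[K]_3) j : (forall i, B i iz = ez_point K i) ->
    (mderiv j (linear_change B G)).@[ez_point K] =
    B ix j * (mderiv ix G).@[ez_point K] + B iy j * (mderiv iy G).@[ez_point K].
  move=> hB; rewrite mderiv_linear_change sum3 !mevalD !mevalZ !meval_linear_change_ez.
  by rewrite !(meval_eq _ hB) gz mulr0 addr0.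
move: gi gz dB; set gx := (mderiv ix G).@[_]; set gy := (mderiv iy G).@[_].
set gz := (mderiv iz G).@[_] => gi gz0 dB.
have [gy0|gy0] := eqVneq gy 0.
  have gx0 : gx != 0 by elim/ord3P: i gi => //; rewrite -/gx -/gy -/gz ?gy0 ?gz0 ?eqxx.
  (* The tangent is x = 0: exchange x and y. *)
  pose B : 'M[K]_3 := \matrix_(i, j) (tperm ix iy j == i)%:R.
  have hB k : B k iz = ez_point K k by rewrite mxE tpermD // eq_sym.
  exists B; first by rewrite unitmxE unitfE det3 !mxE tpermL tpermR tpermD //= !(mulr0, mul0r, mulr1, subr0, sub0r, addr0, oppr_eq0) oner_eq0.
  by split=> //; rewrite dB // !mxE ?tpermL ?tpermR /= ?mul0r ?mul1r ?add0r ?addr0.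
(* The shear replacing y by y - (gx / gy) x cancels the x-derivative. *)
pose B : 'M[K]_3 := \matrix_(i, j) ((i == j)%:R - ((i == iy) && (j == ix))%:R * (gx / gy)).
have hB k : B k iz = ez_point K k by rewrite mxE andbF mul0r subr0.
exists B; first by rewrite unitmxE unitfE det3 !mxE /= !(mulr0, mul0r, mulr1, subr0, sub0r, addr0) oner_eq0.
split=> //; rewrite dB // !mxE /=.
  by rewrite mul0r subr0 !mul1r sub0r mulNr divfK // subrr.
by rewrite !mul0r !subr0 mul0r add0r mul1r.
Qed.

(** In coordinates where [v] is the origin with tangent y = 0, divisibility would force the curve to
    contain that line; then y would divide an irreducible form of degree at least two. *)
Lemma hessian_not_divisible d F v : F \is d.+2.-homog -> irreducible_elt F ->
  (exists i, v i != 0) -> F.@[v] = 0 -> (exists i, (mderiv i F).@[v] != 0) ->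
  ~ divides F (hessian F).
Proof.
move=> hF FI v0 Fv [j Fj] dv.
have [A AU Av] := complete_to_basis v0.
have evA p : (linear_change A p).@[ez_point K] = p.@[v].
  by rewrite meval_linear_change_ez; apply: meval_eq.
have [B BU [hB Bx By]] : exists2 B, B \in unitmx & [/\ forall i, B i iz = ez_point K i,
    (mderiv ix (linear_change B (linear_change A F))).@[ez_point K] = 0 &
    (mderiv iy (linear_change B (linear_change A F))).@[ez_point K] != 0].
  apply: tangent_coordinates.
    by apply: (@mderiv_iz_ez _ d.+1); rewrite ?evA //; apply: linear_change_homog.
  (* The gradient in the new coordinates is the row [g] times [A]; if it vanished, so would [g]. *)
  apply: NNPP => no; move/eqP: Fj; apply.
  pose g : 'rV[K]_3 := \row_i (mderiv i F).@[v].
  have gA : g *m A = 0.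
    apply/rowP=> k; rewrite !mxE; apply/eqP/negPn/negP => nz; apply: no; exists k.
    rewrite mderiv_linear_change raddf_sum /=; move: nz; congr (_ != 0).
    by apply: eq_bigr => i _; rewrite mevalZ evA mxE mulrC.
  have /rowP/(_ j) : g = 0 by rewrite -(mulmxK AU g) gA mul0mx.
  by rewrite !mxE.
set C := A *m B; have CU : C \in unitmx by rewrite unitmx_mul AU.
rewrite linear_change_comp -/C in Bx By.
set G := linear_change C F in Bx By.
have hG : G \is d.+2.-homog by apply: linear_change_homog.
have GI : irreducible_elt G by apply: linear_change_irreducible.
have ez0 p : (on_line p).[0] = p.@[ez_point K].
  rewrite horner_on_line; apply: meval_eq; apply: ord3P; rewrite /line_point /=.
  - by rewrite hornerX.
  - by rewrite horner0.
  - by rewrite hornerC.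
have Gdv : divides G (hessian G).
  case: dv => R defR; rewrite /G hessian_linear_change defR linear_changeM.
  by exists ((\det C) ^+ 2 *: linear_change C R); rewrite scalerAr.
have Gez : G.@[ez_point K] = 0.
  by rewrite /G -linear_change_comp meval_linear_change_ez (meval_eq _ hB) evA.
have /(divides_y hG)[G' defG] : on_line G = 0.
  by apply: (flex_line hG _ _ _ Gdv); rewrite ez0.
have [G0 _ /(_ _ _ defG)[yU|G'U]] := GI.
  have /(rmorph_unit (meval (fun=> 0 : K))) := yU.
  by rewrite /= mevalXU unitr0.
have defG' : G' = (G'@_0%MM)%:MP by move: G'U => /andP[/eqP].
suff /(dhomog_uniq G0 hG) : G \is 1.-homog by [].
rewrite defG defG' mulrC mul_mpolyC; apply: rpredZ.
by rewrite dhomogX /= mdeg1.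
Qed.

End SmoothPoint.

(** * Existence of a smooth point *)

Section Nonvanishing.
Variable K : numFieldType.

(** In characteristic zero the first [size p] integers are distinct, and they are too many to be all
    roots. *)
Lemma poly_nonroot (p : {poly K}) : p != 0 -> exists c, p.[c] != 0.
Proof.
move=> p0; apply: NNPP => no.
have /(max_poly_roots p0) : all (root p) [seq i%:R | i <- iota 0 (size p)].
  apply/allP=> c _; rewrite rootE; apply/negPn/negP => nz; apply: no; by exists c.
rewrite size_map size_iota ltnn => /(_ _)/negP[] //.
by rewrite map_inj_uniq ?iota_uniq // => i j /eqP; rewrite eqr_nat => /eqP.
Qed.

Lemma mpoly_nonvanishing n (F : {mpoly K[n]}) : F != 0 -> exists v, F.@[v] != 0.
Proof.
elim: n F => [|n IH] F F0.
  by exists (fun=> 0); rewrite [F]nvar0_mpolyC mevalC; move: F0; rewrite {1}[F]nvar0_mpolyC mpolyC_eq0.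
(* Evaluation of the last variable at [c] and of the others at [v]. By [evE] it is the evaluation at
   a point whose coordinates need not be computed. *)
pose ev (v : 'I_n -> K) c (G : {mpoly K[n.+1]}) : K := ((muni G).[c%:MP]).@[v].
have evE v c : ev v c F = F.@[fun i => ev v c 'X_i].
  elim/mpoly_alg_ind: (F) => [a|i|p q IHp IHq|p q IHp IHq].
  - by rewrite /ev muniC hornerC !mevalC.
  - by rewrite mevalXU.
  - by rewrite [in RHS]mevalD -IHp -IHq /ev muniD hornerD mevalD.
  - by rewrite [in RHS]mevalM -IHp -IHq /ev muniM hornerM mevalM.
have u0 : muni F != 0.
  by apply: contraNneq F0 => h; apply/eqP/(@muni_inj n K); rewrite muni0.
have [|v vP] := IH (lead_coef (muni F)); first by rewrite lead_coef_eq0.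
pose q : {poly K} := \poly_(i < size (muni F)) ((muni F)`_i).@[v].
have qE c : q.[c] = ev v c F.
  rewrite horner_poly /ev horner_coef raddf_sum /=; apply: eq_bigr => i _.
  by rewrite mevalM rmorphXn /= mevalC.
have [|c] := @poly_nonroot q.
  apply: contraNneq vP => /(congr1 (fun p : {poly K} => p`_(size (muni F)).-1)).
  rewrite coef_poly coef0 lead_coefE -[in X in if X then _ else _]polySpred // leqnn.
  by move=> ->.
by rewrite qE evE; exists (fun i => ev v c 'X_i).
Qed.

End Nonvanishing.

Section ExistsSmoothPoint.
Variable K : numClosedFieldType.

(** If all points were singular, the curve would lie in the finite set [pts]. But the lines through
    a point off the curve all meet the curve, and away from that common point they are disjoint:
    more lines than points gives a contradiction. *)
Lemma exists_smooth_point d (F : {mpoly K[3]}) (T : finType) (pts : T -> 'I_3 -> K) :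
    F \is d.+1.-homog -> F != 0 ->
    (forall v, (exists i, v i != 0) -> F.@[v] = 0 -> (forall i, (mderiv i F).@[v] = 0) ->
      exists t c, forall i, v i = c * pts t i) ->
  exists v, [/\ exists i, v i != 0, F.@[v] = 0 & exists i, (mderiv i F).@[v] != 0].
Proof.
move=> hF F0 sing; apply: NNPP => no.
have {}sing v : (exists i, v i != 0) -> F.@[v] = 0 -> exists t c, forall i, v i = c * pts t i.
  move=> v0 Fv; apply: sing => // i; apply/eqP/negPn/negP => Fi.
  by apply: no; exists v; split=> //; exists i.
have [w Fw] := mpoly_nonvanishing F0.
have [|A AU Aw] := @complete_to_basis _ w.
  apply: NNPP => w0; move/eqP: Fw; apply.
  have w00 i : w i = 0 by apply/eqP/negPn/negP => nz; apply: w0; exists i.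
  rewrite (meval_eq _ w00) mevalE big1_seq // => m /andP[_ /(dhomog_mf hF)] /= dm.
  have : m != 0%MM by rewrite -mdeg_eq0 dm.
  rewrite -mdeg_eq0 mdegE sum_nat_eq0 negb_forall => /existsP[i /= mi].
  by rewrite (bigD1 i) //= expr0n (negPf mi) mul0r mulr0.
pose G := linear_change A F; have hG : G \is d.+1.-homog by apply: linear_change_homog.
have Gz : G.@[ez_point K] != 0 by rewrite meval_linear_change_ez (meval_eq _ Aw).
pose line (s : K) (i : 'I_3) : {poly K} := if i == ix then s%:P else if i == iy then 1 else 'X.
pose pt s t i := (line s i).[t].
have root_line s : exists t, G.@[pt s t] = 0.
  have horn t : (mmap polyC (line s) G).[t] = G.@[pt s t].
    elim/mpoly_alg_ind: (G) => [c|i|p q IHp IHq|p q IHp IHq].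
    - by rewrite mmapC hornerC mevalC.
    - by rewrite mmapX mmap1U mevalXU.
    - by rewrite rmorphD hornerD mevalD IHp IHq.
    - by rewrite rmorphM hornerM mevalM IHp IHq.
  (* On the line of points (s : 1 : t), the coefficient of t to the power [d.+1] is the value of [G]
     at (0 : 0 : 1), which is nonzero; so the restriction is not constant and has a root. *)
  suff sz : size (mmap polyC (line s) G) != 1%N.
    by have /closed_rootP[t /eqP] := sz; rewrite horn; exists t.
  apply: contraNneq Gz => sz1.
  suff -> : G.@[ez_point K] = (mmap polyC (line s) G)`_d.+1 by rewrite nth_default ?sz1.
  rewrite coef_sum mevalE; apply: eq_big_seq => m /(dhomog_mf hG); rewrite /= mdegE sumn3 => dm.
  rewrite coefCM; congr (_ * _); rewrite /mmap1 !prod3.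
  rewrite /line /ez_point /= !expr0n !expr1n !mulr1 -rmorphXn /= coefCM coefXn.
  have [m2|m2] := eqVneq (m iz) d.+1.
    have -> : m ix = 0%N by lia.
    have -> : m iy = 0%N by lia.
    by rewrite expr0 eqxx !mulr1.
  rewrite mulr0; case: eqP => mx; rewrite ?mul0r // mul1r; case: eqP => my //.
  by case/eqP: m2; lia.
(* One more line than there are points in [T]; two of them must then share a point. *)
have pick (s : 'I_#|T|.+1) : exists t, exists r c, forall i,
    \sum_(j < 3) A i j * pt s%:R r j = c * pts t i.
  have [r Gr] := root_line s%:R.
  have [||t [c h]] := sing (fun i => \sum_(j < 3) A i j * pt s%:R r j).
  - apply: NNPP => v0; pose u : 'cV[K]_3 := \col_j pt s%:R r j.
    have Au : A *m u = 0.
      apply/colP=> i; rewrite !mxE; apply/eqP/negPn/negP => nz; apply: v0; exists i.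
      by move: nz; congr (_ != 0); apply: eq_bigr => j _; rewrite mxE.
    have /colP/(_ iy) : u = 0 by rewrite -(mulKmx AU u) Au mulmx0.
    by rewrite !mxE /pt /line /= hornerC => /eqP; rewrite oner_eq0.
  - by rewrite -meval_linear_change.
  by exists t, r, c.
have [tau tauP] := fin_all_exists pick.
have /leq_card : injective tau; last by rewrite card_ord ltnn.
move=> s s' ett; have [r [c h]] := tauP s; have [r' [c' h']] := tauP s'.
pose u : 'cV[K]_3 := \col_j pt s%:R r j; pose u' : 'cV[K]_3 := \col_j pt s'%:R r' j.
have eqA : A *m (c' *: u) = A *m (c *: u').
  apply/colP=> i; rewrite -!scalemxAr !mxE.
  under eq_bigr do rewrite mxE; under [in RHS]eq_bigr do rewrite mxE.
  by rewrite h h' ett; ring.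
have {eqA}/colP eqU : c' *: u = c *: u' by rewrite -(mulKmx AU (c' *: u)) eqA mulKmx.
have := eqU iy; rewrite !mxE /pt /line /= !hornerC !mulr1 => ec.
have c0 : c != 0.
  apply: contraTneq isT => c0; have Au : A *m u = 0.
    apply/colP=> i; rewrite !mxE; transitivity (c * pts (tau s) i).
      by rewrite -h; apply: eq_bigr => j _; rewrite mxE.
    by rewrite c0 mul0r.
  have /colP/(_ iy) : u = 0 by rewrite -(mulKmx AU u) Au mulmx0.
  by rewrite !mxE /pt /line /= hornerC => /eqP; rewrite oner_eq0.
have := eqU ix; rewrite !mxE /pt /line /= !hornerC ec => /(mulfI c0)/eqP.
by rewrite eqr_nat => /eqP/val_inj.
Qed.

End ExistsSmoothPoint.

(** * Counting local conditions *)

Section LinearAlgebra.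
Variables (K : fieldType) (V : vectType K) (J I : finType) (blk : J -> I).

Definition block_part i (g : {ffun J -> K^o}) : {ffun J -> K^o} :=
  [ffun j => if blk j == i then g j else 0].

Lemma block_part_linear i : linear (block_part i).
Proof.
move=> a g h; apply/ffunP=> j; rewrite !ffunE.
by case: ifP => // _; rewrite scaler0 addr0.
Qed.

HB.instance Definition _ i :=
  GRing.isLinear.Build K {ffun J -> K^o} {ffun J -> K^o} _ (block_part i) (block_part_linear i).

Lemma sum_block_part g : g = \sum_i block_part i g.
Proof.
apply/ffunP=> j; rewrite sum_ffunE (bigD1 (blk j)) //= ffunE eqxx big1 ?addr0 // => i ij.
by rewrite ffunE eq_sym (negPf ij).
Qed.

Lemma dim_ffun : \dim {: {ffun J -> K^o}} = #|J|.
Proof. by rewrite dimvf; apply: muln1. Qed.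

(** [Th] is onto, so its kernel has codimension [#|J|]; the image of [U] has dimension at most [r]
    in each block, hence at most [#|I| * r] in all. Rank-nullity for [U] concludes. *)
Lemma local_conditions_count (Th : 'Hom(V, {ffun J -> K^o})) (U : {vspace V}) r :
  (forall j0, exists v, forall j, Th v j = (j == j0)%:R) ->
  (forall i, exists xs : r.-tuple V, forall u, u \in U ->
     exists2 v, v \in <<xs>>%VS & forall j, blk j = i -> Th u j = Th v j) ->
  (#|J| + \dim U <= \dim {: V} + #|I| * r)%N.
Proof.
move=> onto small.
have full : limg Th = fullv.
  apply/eqP; rewrite eqEsubv subvf; apply/subvP=> g _.
  have -> : g = \sum_j g j *: [ffun k => (k == j)%:R : K^o].
    apply/ffunP=> k; rewrite sum_ffunE (bigD1 k) //= !ffunE eqxx big1 => [|j jk].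
      by rewrite addr0 [_ *: _]mulr1.
    by rewrite !ffunE eq_sym (negPf jk) scaler0.
  apply: memv_suml => j _; apply: memvZ; have [v vP] := onto j.
  by rewrite (_ : [ffun _ => _] = Th v) ?memv_img ?memvf //; apply/ffunP=> k; rewrite ffunE vP.
have dimV : (\dim (lker Th) + #|J| = \dim {: V})%N.
  by rewrite -(limg_ker_dim Th fullv) full dim_ffun capfv.
have [xs xsP] := fin_all_exists small.
have sub : (Th @: U <= \sum_i <<[seq linfun (block_part i) x | x <- [seq Th x | x <- xs i]]>>)%VS.
  apply/subvP=> _ /memv_imgP[u uU ->]; rewrite [Th u]sum_block_part.
  apply: memv_sumr => i _; have [v vx eqv] := xsP i u uU.
  have -> : block_part i (Th u) = linfun (block_part i) (Th v).
    by rewrite lfunE; apply/ffunP=> j; rewrite !ffunE; case: eqP => // /eqv.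
  by rewrite -!limg_span !memv_img.
have dimU : (\dim (Th @: U) <= #|I| * r)%N.
  apply: leq_trans (dimvS sub) _; apply: leq_trans (dimv_leq_sum _ _ _) _.
  rewrite -sum_nat_const; apply: leq_sum => i _.
  by apply: leq_trans (dim_span _) _; rewrite !size_map size_tuple.
have := limg_ker_dim Th U; have : (\dim (U :&: lker Th) <= \dim (lker Th))%N by rewrite dimvS ?capvSr.
move: dimU dimV; move: (\dim (Th @: U)) (\dim (lker Th)) (\dim U) (\dim (U :&: lker Th)).
by move=> a b c e; lia.
Qed.

End LinearAlgebra.

(** * The ideal (F, H) in a fixed degree *)

Section IdealDegree.
Variables (K : fieldType) (n : nat).
Implicit Types (F H : {mpoly K[n.+1]}).

Lemma homog_quotient d e F c : F != 0 -> F \is d.-homog -> F * c \is (d + e).-homog ->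
  c \is e.-homog.
Proof.
move=> F0 hF hFc; suff -> : c = pihomog mdeg e c by apply: pihomogP.
apply: (mulfI F0); rewrite -[LHS](@pihomog_dE _ _ mdeg (d + e)) //.
rewrite {1}(@pihomog_partitionE _ _ mdeg (maxn (msize c) e.+1) c) ?leq_maxl //.
rewrite mulr_sumr linear_sum /= (bigD1 (Ordinal (leq_maxr (msize c) e.+1))) //=.
rewrite pihomog_dE ?dhomogM ?pihomogP // big1 ?addr0 // => i ie.
apply: (@pihomog_ne0 _ _ _ (d + i) (d + e)); last by rewrite dhomogM ?pihomogP.
by rewrite eqn_add2l; apply: contraNneq ie => ie; apply/eqP/val_inj.
Qed.

(** The Koszul relations: when H is regular modulo F, the kernel of (a, b) |-> F a + H b consists of
    the pairs (- H c, F c), with c of degree [t]. *)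
Lemma degree_ideal_dim d e t F H : F != 0 -> F \is d.-homog -> H \is e.-homog ->
  (forall b, divides F (H * b) -> divides F b) ->
  exists U : {vspace dhomog n.+1 K (d + (e + t))},
    (forall u, u \in U -> exists a b : {mpoly K[n.+1]},
       [/\ a \is (e + t).-homog, b \is (d + t).-homog & val u = F * a + H * b]) /\
    (\dim {: dhomog n.+1 K (e + t)} + \dim {: dhomog n.+1 K (d + t)}
       <= \dim U + \dim {: dhomog n.+1 K t})%N.
Proof.
move=> F0 hF hH reg.
pose S k := dhomog n.+1 K k.
have pf (ab : S (e + t)%N * S (d + t)%N) : F * val ab.1 + H * val ab.2 \is (d + (e + t)).-homog.
  apply: rpredD; first by apply: dhomogM => //; apply: dhomog_is_dhomog.
  by rewrite addnCA; apply: dhomogM => //; apply: dhomog_is_dhomog.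
have vE k (a : K) (x y : S k) : val (a *: x + y) = a *: val x + val y by [].
pose f ab : S (d + (e + t))%N := DHomog (pf ab).
have f_lin : linear f.
  move=> a u v; apply/val_inj; rewrite vE.
  change (F * val (a *: u.1 + v.1) + H * val (a *: u.2 + v.2) =
    a *: (F * val u.1 + H * val u.2) + (F * val v.1 + H * val v.2)).
  by rewrite !vE !mulrDr !scalerDr -!scalerAr addrACA.
pose fL : {linear _ -> _} := HB.pack f (GRing.isLinear.Build _ _ _ _ f f_lin).
exists (limg (linfun fL)); split.
  move=> _ /memv_imgP[ab _ ->]; exists (val ab.1), (val ab.2).
  by split; rewrite ?dhomog_is_dhomog // lfunE.
have qf (c : S t) : - (H * val c) \is (e + t).-homog.
  by rewrite rpredN; apply: dhomogM => //; apply: dhomog_is_dhomog.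
have qg (c : S t) : F * val c \is (d + t).-homog.
  by apply: dhomogM => //; apply: dhomog_is_dhomog.
pose g c : S (e + t)%N * S (d + t)%N := (DHomog (qf c), DHomog (qg c)).
have g_lin : linear g.
  move=> a u v; congr pair; apply/val_inj.
    change (- (H * val (a *: u + v)) = a *: - (H * val u) + - (H * val v)).
    by rewrite vE mulrDr -scalerAr opprD scalerN.
  change (F * val (a *: u + v) = a *: (F * val u) + F * val v).
  by rewrite vE mulrDr -scalerAr.
pose gL : {linear _ -> _} := HB.pack g (GRing.isLinear.Build _ _ _ _ g g_lin).
have ker : (lker (linfun fL) <= limg (linfun gL))%VS.
  apply/subvP=> -[a b]; rewrite memv_ker lfunE => /eqP/(congr1 val) /= eq0.
  have [c defb] : divides F (val b).
    by apply: reg; exists (- val a); rewrite mulrN; apply/eqP; rewrite -addr_eq0 addrC eq0.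
  have hc : c \is t.-homog.
    by apply: (homog_quotient F0 hF); rewrite -defb; apply: dhomog_is_dhomog.
  apply/memv_imgP; exists (DHomog hc : S t); first exact: memvf.
  have -> : linfun gL (DHomog hc) = g (DHomog hc) by apply: lfunE.
  rewrite /g; congr pair; apply/val_inj => //=.
  apply: (mulfI F0); apply/eqP; rewrite mulrN -addr_eq0 -[X in _ == X]eq0 /=.
  by rewrite defb; apply/eqP; ring.
have dimf := limg_ker_dim (linfun fL) fullv; rewrite capfv in dimf.
have dimg := limg_ker_dim (linfun gL) fullv.
have dimP : \dim {: (S (e + t)%N * S (d + t)%N)%type} = (\dim {: S (e + t)%N} + \dim {: S (d + t)%N})%N.
  by rewrite !dimvf.
have := dimvS ker; move: dimf dimg; rewrite dimP /S.
move: (\dim (lker (linfun fL))) (\dim (limg (linfun fL))) (\dim (limg (linfun gL))).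
move: (\dim (fullv :&: lker (linfun gL))) => w x y z e1 e2 e3.
by rewrite -e2 -e1; move: e3; clear; lia.
Qed.

End IdealDegree.

Definition plane_weight (p q : nat) (i : 'I_3) : nat :=
  if i == ix then p else if i == iy then q else 0.

Lemma plane_weightE p q (m : 'X_{1..3}) :
  weight (plane_weight p q) m = (p * m ix + q * m iy)%N.
Proof. by rewrite /weight sumn3 /plane_weight /= mul0n addn0. Qed.

(** The homogenization of x^a y^b in degree [k]; it has that degree only when [a + b <= k]. *)
Definition affine_mnm k a b : 'X_{1..3} :=
  (U_(ix) *+ a + U_(iy) *+ b + U_(iz) *+ (k - (a + b)))%MM.

Lemma affine_mnm_ix k a b : affine_mnm k a b ix = a.
Proof. by rewrite /affine_mnm !mnmDE !mulmnE !mnm1E /= mul1n !mul0n !addn0. Qed.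

Lemma affine_mnm_iy k a b : affine_mnm k a b iy = b.
Proof. by rewrite /affine_mnm !mnmDE !mulmnE !mnm1E /= mul1n !mul0n addn0. Qed.

Lemma affine_mnm_iz k a b : affine_mnm k a b iz = (k - (a + b))%N.
Proof. by rewrite /affine_mnm !mnmDE !mulmnE !mnm1E /= mul1n !mul0n. Qed.

Lemma mdeg_affine_mnm k a b : (a + b <= k)%N -> mdeg (affine_mnm k a b) = k.
Proof. by rewrite mdegE sumn3 affine_mnm_ix affine_mnm_iy affine_mnm_iz; lia. Qed.

Lemma affine_mnmE k (m : 'X_{1..3}) : mdeg m = k -> m = affine_mnm k (m ix) (m iy).
Proof.
rewrite mdegE sumn3 => dm; apply/mnmP.
by apply: ord3P; rewrite ?affine_mnm_ix ?affine_mnm_iy ?affine_mnm_iz //; lia.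
Qed.

Lemma affine_mnmD k l a b : (a + b <= k)%N ->
  (U_(iz) *+ l + affine_mnm k a b)%MM = affine_mnm (l + k) a b.
Proof.
move=> le; apply/mnmP; apply: ord3P; rewrite mnmDE mulmnE mnm1E /= ?mul0n ?mul1n;
  rewrite ?affine_mnm_ix ?affine_mnm_iy ?affine_mnm_iz //; lia.
Qed.

(** * Prescribing jets at finitely many points *)

Section Interpolation.
Variable K : numFieldType.
Implicit Types (F G P E : {mpoly K[3]}).

Lemma weight_ge1_ez d G : G \is d.-homog -> G.@[ez_point K] = 0 ->
  weight_ge (plane_weight 1 1) 1 G.
Proof.
move=> /dhomogP hG G0 m; rewrite plane_weightE !mul1n => w0.
have [mG|/memN_msupp_eq0//] := boolP (m \in msupp G).
have mx : m ix = 0%N by lia.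
have my : m iy = 0%N by lia.
move: G0; rewrite mevalE (bigD1_seq m) ?msupp_uniq //= prod3 mx my !expr0 !mul1r expr1n mulr1.
rewrite big1_seq ?addr0 // => m' /andP[m'm m'G]; have := hG _ mG; have := hG _ m'G.
rewrite /= !mdegE !sumn3 mx my => dm' dm.
have /orP nz : (m' ix != 0%N) || (m' iy != 0%N).
  rewrite -negb_and; apply: contra m'm => /andP[/eqP m'x /eqP m'y].
  by apply/eqP/mnmP; apply: ord3P; lia.
case: nz => nz; last first.
  by rewrite (bigD1 iy) //= /ez_point /= expr0n (negPf nz) mul0r mulr0.
by rewrite (bigD1 ix) //= /ez_point /= expr0n (negPf nz) mul0r mulr0.
Qed.

(* [P] is a unit modulo the tenth power of the maximal ideal of e_z, as
   c^10 z^(10 D) = (P - E)^10 with E in the maximal ideal. *)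
Lemma local_inverse D P : P \is D.-homog -> P.@[ez_point K] != 0 ->
  exists Q E, [/\ Q \is (9 * D).-homog, weight_ge (plane_weight 1 1) 10 E &
    P * Q = 'X_[U_(iz) *+ (10 * D)] + E].
Proof.
move=> hP; set c := P.@[_] => c0.
pose Z : {mpoly K[3]} := c *: 'X_[U_(iz) *+ D]; pose E := P - Z.
have hZ : Z \is D.-homog by apply: dhomogZ; rewrite dhomogX /= mdegMn mdeg1 mul1n.
have hE : E \is D.-homog by apply: rpredB.
have wE : weight_ge (plane_weight 1 1) 1 E.
  apply: (weight_ge1_ez hE); rewrite mevalB mevalZ mevalX.
  rewrite big1 ?mulr1 ?subrr //; apply: ord3P => _; rewrite mulmnE mnm1E /= ?mul0n ?expr0 //.
  by rewrite /ez_point expr1n.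
pose S := \sum_(i < 10) Z ^+ (10.-1 - i) * (- E) ^+ i.
have defS : Z ^+ 10 - (- E) ^+ 10 = P * S.
  by rewrite subrXX opprK; congr (_ * _); rewrite /E addrC subrK.
exists (c ^- 10 *: S), (- (c ^- 10 *: (- E) ^+ 10)); split.
- apply: dhomogZ; apply: rpred_sum => i _.
  have -> : (9 * D = D * (10.-1 - i) + D * i)%N by case: i => i /= lt; nia.
  by apply: dhomogM; apply: dhomogMn => //; rewrite rpredN.
- apply/weight_geN/weight_geZ; rewrite -[10%N]muln1; apply: weight_ge_exp.
  exact: weight_geN.
rewrite -scalerAr -defS scalerBr /Z exprZn scalerA mulVf ?expf_neq0 // scale1r.
rewrite mpolyXn; congr ('X_[_] - _).
by apply/mnmP=> j; rewrite !mulmnE; nia.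
Qed.

Section Points.
Variables (T : finType) (A : T -> 'M[K]_3).
Hypothesis A_unit : forall i, A i \in unitmx.
Hypothesis A_distinct : forall i j, i != j ->
  ~ exists c, forall r, A i r iz = c * A j r iz.

(** In the coordinates of [A j], one of x, y is nonzero at the point of [A i], since otherwise the
    two points would coincide. *)
Lemma separating_linear_form i j : i != j ->
  exists2 L : {mpoly K[3]}, L \is 1.-homog &
    weight_ge (plane_weight 1 1) 1 (linear_change (A j) L) /\
    (linear_change (A i) L).@[ez_point K] != 0.
Proof.
move=> ij; pose M := invmx (A j) *m A i.
have [s sz Ms] : exists2 s, s != iz & M s iz != 0.
  apply: NNPP => no; apply: (A_distinct ij); exists (M iz iz) => r.
  have Mx0 s : s != iz -> M s iz = 0.
    by move=> sz; apply/eqP/negPn/negP => nz; apply: no; exists s.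
  have /matrixP/(_ r iz) : A i = A j *m M by rewrite mulKVmx.
  by rewrite [in X in _ = X -> _]mxE sum3 (Mx0 ix) // (Mx0 iy) // !mulr0 !add0r mulrC.
exists (linear_change (invmx (A j)) 'X_s).
  by apply: linear_change_homog; rewrite dhomogX /= mdeg1.
split.
  rewrite linear_change_unitV //.
  have := @weight_geX 3 K (plane_weight 1 1) U_(s); rewrite weightU.
  by elim/ord3P: s sz {Ms}.
by rewrite linear_change_comp meval_linear_change_ez mevalXU.
Qed.

(** The product over the other points of the tenth powers of forms separating them from [i0]. *)
Lemma vanishing_form i0 : exists M D,
  [/\ (D <= 10 * #|T|)%N, M \is D.-homog,
      forall i, i != i0 -> weight_ge (plane_weight 1 1) 10 (linear_change (A i) M) &
      (linear_change (A i0) M).@[ez_point K] != 0].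
Proof.
have pick i : exists L : {mpoly K[3]}, i != i0 -> L \is 1.-homog /\
    weight_ge (plane_weight 1 1) 1 (linear_change (A i) L) /\
    (linear_change (A i0) L).@[ez_point K] != 0.
  have [->|ii0] := eqVneq i i0; first by exists 0.
  by have [|L hL [w nz]] := @separating_linear_form i0 i; rewrite 1?eq_sym //; exists L.
have [L LP] := fin_all_exists pick.
exists (\prod_(i | i != i0) L i ^+ 10), (\sum_(i | i != i0) 10)%N; split.
- by rewrite sum_nat_const mulnC leq_mul2l max_card.
- elim/big_ind2: _ => [|? ? ? ?|i /LP[hL _]]; [exact: dhomog1|exact: dhomogM|].
  by have := dhomogMn 10 hL; rewrite mul1n.
- move=> i ii0; rewrite (bigD1 i) //= linear_changeM; have [_ [w _]] := LP i ii0.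
  apply: (@weight_geM _ _ _ 10 0) => //.
  rewrite (_ : linear_change _ _ = linear_change (A i) (L i) ^+ 10) ?rmorphXn //.
  exact: (@weight_ge_exp _ _ _ 1 _ 10).
rewrite (_ : _.@[_] = \prod_(i | i != i0) (linear_change (A i0) (L i)).@[ez_point K] ^+ 10).
  apply/prodf_neq0 => i /LP[_ [_ nz]]; exact: expf_neq0.
by rewrite !rmorph_prod; apply: eq_bigr => i _; rewrite !rmorphXn.
Qed.

(** A form vanishing to order ten at the other points is inverted modulo order ten at [i0] and then
    multiplied by the desired monomial. *)
Lemma interpolation i0 a b k : (a + b < 10)%N -> (100 * #|T| + 10 <= k)%N ->
  exists2 G : {mpoly K[3]}, G \is k.-homog &
    (forall i, i != i0 -> weight_ge (plane_weight 1 1) 10 (linear_change (A i) G)) /\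
    weight_ge (plane_weight 1 1) 10 (linear_change (A i0) G - 'X_[affine_mnm k a b]).
Proof.
move=> ab hk; have [M [D [leD hM Mi Mi0]]] := vanishing_form i0.
have [Q [E [hQ wE eqQ]]] := local_inverse (linear_change_homog (A i0) hM) Mi0.
(* [M] and its local inverse [Q] use up degree [10 * D]; the bound on [k] leaves [l] at least 10,
   enough for x^a y^b. *)
pose l := (k - 10 * D)%N.
exists (M * linear_change (invmx (A i0)) (Q * 'X_[affine_mnm l a b])).
  have -> : k = (D + (9 * D + l))%N by rewrite /l; lia.
  apply: dhomogM => //; apply: linear_change_homog; apply: dhomogM => //.
  by rewrite dhomogX /= mdeg_affine_mnm // /l; lia.
split=> [i ii0|].
  by rewrite linear_changeM; apply: (@weight_geM _ _ _ 10 0) => //; apply: Mi.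
rewrite linear_changeM linear_change_unitV // mulrA eqQ mulrDl -mpolyXD affine_mnmD; last by rewrite /l; lia.
rewrite (_ : (10 * D + l)%N = k); last by rewrite /l; lia.
by rewrite addrAC subrr add0r; apply: (@weight_geM _ _ _ 10 0).
Qed.

End Points.
End Interpolation.

(** * Local bounds at cusps and nodes *)

Section LocalConditions.
Variable K : numFieldType.
Implicit Types (F G H : {mpoly K[3]}) (A : 'M[K]_3).

(** [L] need only contain the low monomials that occur in [G]; with [L] empty, the lemma turns
    vanishing coefficients into a weight bound. *)
Lemma weight_ge_truncation s p q N G (L : seq (nat * nat)) :
    G \is s.-homog -> uniq L ->
    (forall a b, (p * a + q * b < N)%N -> G@_(affine_mnm s a b) != 0 -> (a, b) \in L) ->
  weight_ge (plane_weight p q) N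
    (G - \sum_(u <- L) G@_(affine_mnm s u.1 u.2) *: 'X_[affine_mnm s u.1 u.2]).
Proof.
move=> /dhomogP hG uL cov m; rewrite plane_weightE => wm.
rewrite mcoeffB raddf_sum /=.
have [mG|/memN_msupp_eq0 mG] := boolP (m \in msupp G); last first.
  rewrite mG sub0r big1 ?oppr0 // => u _; rewrite mcoeffZ mcoeffX.
  by case: eqP => [->|_]; rewrite ?mG ?mul0r ?mulr0.
have em := affine_mnmE (hG _ mG); have mL : (m ix, m iy) \in L.
  by apply: cov => //; rewrite -em -mcoeff_msupp.
rewrite (bigD1_seq (m ix, m iy)) //= -em mcoeffZ mcoeffX eqxx mulr1.
rewrite big1_seq ?addr0 ?subrr // => -[a b] /= /andP[ne _].
rewrite mcoeffZ mcoeffX; case: eqP => [e|]; last by rewrite mulr0.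
by case/eqP: ne; rewrite -e affine_mnm_ix affine_mnm_iy.
Qed.

(* The local multiplicity of (F, H) is then at least the number of monomials in
   x, y of weight less than [N], minus four. *)
Definition four_generated A p q N d e t F H : Prop :=
  exists xs : 4.-tuple {mpoly K[3]},
    (forall j, tnth xs j \is (d + (e + t)).-homog) /\
    forall a b : {mpoly K[3]}, a \is (e + t).-homog -> b \is (d + t).-homog ->
      exists c : 'I_4 -> K, weight_ge (plane_weight p q) N
        (linear_change A (F * a + H * b - \sum_j c j *: tnth xs j)).

Lemma sum4 (V : nmodType) (f : 'I_4 -> V) :
  \sum_(j < 4) f j = f (inord 0) + f (inord 1) + f (inord 2) + f (inord 3).
Proof.
rewrite !big_ord_recr big_ord0 /= add0r.
by congr (f _ + f _ + f _ + f _); apply: ord_inj; rewrite inordK.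
Qed.

(** The generators may be sought in the local coordinates, then carried back by the inverse of
    [A]. *)
Lemma four_generatedI A p q N d e t F H (x0 x1 x2 x3 : {mpoly K[3]}) :
    A \in unitmx -> F \is d.-homog -> H \is e.-homog ->
    (forall x, x \in [:: x0; x1; x2; x3] -> x \is (d + (e + t)).-homog) ->
    (forall a b : {mpoly K[3]}, a \is (e + t).-homog -> b \is (d + t).-homog ->
      exists c0 c1 c2 c3 : K, weight_ge (plane_weight p q) N
        (linear_change A F * a + linear_change A H * b
          - (c0 *: x0 + c1 *: x1 + c2 *: x2 + c3 *: x3))) ->
  four_generated A p q N d e t F H.
Proof.
move=> AU hF hH hx gen.
exists [tuple linear_change (invmx A) x0; linear_change (invmx A) x1;
              linear_change (invmx A) x2; linear_change (invmx A) x3]; split.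
  move=> j; have : tnth [tuple x0; x1; x2; x3] j \in [:: x0; x1; x2; x3] by apply: mem_tnth.
  move=> /hx/(linear_change_homog (invmx A)).
  by rewrite !(tnth_nth 0) /=; case: j => -[|[|[|[|]]]].
move=> a b ha hb.
have [c0 [c1 [c2 [c3 w]]]] := gen _ _ (linear_change_homog A ha) (linear_change_homog A hb).
exists (fun j : 'I_4 => nth 0 [:: c0; c1; c2; c3] j).
rewrite (linear_changeB A (F * a + H * b)) (linear_changeD A (F * a)).
rewrite (linear_changeM A F) (linear_changeM A H) linear_change_sum.
rewrite (_ : \sum_(j < 4) _ = c0 *: x0 + c1 *: x1 + c2 *: x2 + c3 *: x3); first exact: w.
transitivity (\sum_(j < 4) nth 0 [:: c0; c1; c2; c3] j *: nth 0 [:: x0; x1; x2; x3] j).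
  apply: eq_bigr => j _; rewrite linear_changeZ (tnth_nth 0); congr (_ *: _).
  by case: j => -[|[|[|[|//]]]] lt; apply: linear_change_unitV.
by rewrite sum4 !inordK.
Qed.

Lemma regroup (f h a b m0 m1 m2 m3 : {mpoly K[3]}) (c0 c1 c2 c3 : K) :
  f * a + h * b - (c0 *: (f * m0) + c1 *: (f * m1) + c2 *: (f * m2) + c3 *: (h * m3)) =
  f * (a - (c0 *: m0 + (c1 *: m1 + (c2 *: m2 + 0)))) + h * (b - (c3 *: m3 + 0)).
Proof. by rewrite -!mul_mpolyC; ring. Qed.

(** Modulo weight 10, the cofactor of F matters only modulo weight 10 - 6 = 4, that is through 1, x,
    y, and that of H modulo weight 10 - 8 = 2, that is through 1. *)
Lemma four_generated_cusp A d e t F H : A \in unitmx -> F \is d.-homog -> H \is e.-homog ->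
  weight_ge (plane_weight 3 2) 6 (linear_change A F) ->
  weight_ge (plane_weight 3 2) 8 (linear_change A H) -> (0 < t)%N ->
  four_generated A 3 2 10 d e t F H.
Proof.
move=> AU hF hH wF wH t0.
have [hFA hHA] := (linear_change_homog A hF, linear_change_homog A hH).
set f := linear_change A F in wF hFA *; set h := linear_change A H in wH hHA *.
apply: (@four_generatedI A 3 2 10 d e t F H
  (f * 'X_[affine_mnm (e + t) 0 0]) (f * 'X_[affine_mnm (e + t) 1 0])
  (f * 'X_[affine_mnm (e + t) 0 1]) (h * 'X_[affine_mnm (d + t) 0 0])) => //.
  have et1 : (0 < e + t)%N by rewrite addn_gt0 t0 orbT.
  move=> x; rewrite !inE => /or4P[] /eqP->.
  - by apply: dhomogM => //; rewrite dhomogX /= mdeg_affine_mnm.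
  - by apply: dhomogM => //; rewrite dhomogX /= mdeg_affine_mnm.
  - by apply: dhomogM => //; rewrite dhomogX /= mdeg_affine_mnm.
  - by rewrite addnCA; apply: dhomogM => //; rewrite dhomogX /= mdeg_affine_mnm.
move=> a b ha hb; rewrite -/f -/h.
have wa := @weight_ge_truncation _ 3 2 4 a [:: (0, 0); (1, 0); (0, 1)]%N ha isT.
have wb := @weight_ge_truncation _ 3 2 2 b [:: (0, 0)]%N hb isT.
rewrite !big_cons !big_nil /= in wa wb.
pose ca u v := a@_(affine_mnm (e + t) u v).
exists (ca 0 0)%N, (ca 1 0)%N, (ca 0 1)%N, b@_(affine_mnm (d + t) 0 0).
rewrite regroup; apply: weight_geD.
  apply: (@weight_geM _ _ _ 6 4) => //; apply: wa => x y lt _.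
  have : ((x == 0) && (y == 0) || (x == 1) && (y == 0) || (x == 0) && (y == 1))%N by lia.
  by case/orP=> [/orP[]|] /andP[/eqP-> /eqP->].
apply: (@weight_geM _ _ _ 8 2) => //; apply: wb => x y lt _.
have : ((x == 0) && (y == 0))%N by lia.
by case/andP=> /eqP-> /eqP->.
Qed.

(** Besides F and H themselves, the generators are x^2 y and x y^2: a combination with cofactors
    vanishing at the node has weight at least 4 for both (1, 2) and (2, 1), and no other monomial of
    degree less than 4 does. *)
Lemma four_generated_node A d e t F H : A \in unitmx -> F \is d.-homog -> H \is e.-homog ->
  weight_ge (plane_weight 1 2) 3 (linear_change A F) ->
  weight_ge (plane_weight 2 1) 3 (linear_change A F) ->
  weight_ge (plane_weight 1 2) 3 (linear_change A H) ->
  weight_ge (plane_weight 2 1) 3 (linear_change A H) -> (3 <= t)%N ->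
  four_generated A 1 1 4 d e t F H.
Proof.
move=> AU hF hH wF wF' wH wH' t3.
have [hFA hHA] := (linear_change_homog A hF, linear_change_homog A hH).
set f := linear_change A F in wF wF' hFA *; set h := linear_change A H in wH wH' hHA *.
pose k := (d + (e + t))%N.
have hM : 'X_[affine_mnm (e + t) 0 0] \is [in K[3], (e + t).-homog].
  by rewrite dhomogX /= mdeg_affine_mnm.
have hM' : 'X_[affine_mnm (d + t) 0 0] \is [in K[3], (d + t).-homog].
  by rewrite dhomogX /= mdeg_affine_mnm.
apply: (@four_generatedI A 1 1 4 d e t F H
  (f * 'X_[affine_mnm (e + t) 0 0]) (h * 'X_[affine_mnm (d + t) 0 0])
  'X_[affine_mnm k 2 1] 'X_[affine_mnm k 1 2]) => //.
  move=> x; rewrite !inE => /or4P[] /eqP->.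
  - exact: dhomogM.
  - by rewrite addnCA; apply: dhomogM.
  - by rewrite dhomogX /= mdeg_affine_mnm //; rewrite /k; lia.
  - by rewrite dhomogX /= mdeg_affine_mnm //; rewrite /k; lia.
move=> a b ha hb; rewrite -/f -/h.
pose a' := a - a@_(affine_mnm (e + t) 0 0) *: 'X_[affine_mnm (e + t) 0 0].
pose b' := b - b@_(affine_mnm (d + t) 0 0) *: 'X_[affine_mnm (d + t) 0 0].
have trunc p q s (g : {mpoly K[3]}) : (0 < p)%N -> (0 < q)%N -> g \is s.-homog ->
    weight_ge (plane_weight p q) 1 (g - g@_(affine_mnm s 0 0) *: 'X_[affine_mnm s 0 0]).
  move=> p0 q0 hg; have := @weight_ge_truncation s p q 1 g [:: (0, 0)]%N hg isT.
  rewrite big_seq1; apply=> x y lt _.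
  have -> : x = 0%N by move: p0 lt; clear; nia.
  by have -> : y = 0%N by move: q0 lt; clear; nia.
pose Q := f * a' + h * b'.
have hQ : Q \is k.-homog.
  apply: rpredD; first by apply: dhomogM => //; apply: rpredB => //; apply: dhomogZ.
  by rewrite /k addnCA; apply: dhomogM => //; apply: rpredB => //; apply: dhomogZ.
have wQ : weight_ge (plane_weight 1 2) 4 Q.
  by apply: weight_geD; apply: (@weight_geM _ _ _ 3 1) => //; apply: trunc.
have wQ' : weight_ge (plane_weight 2 1) 4 Q.
  by apply: weight_geD; apply: (@weight_geM _ _ _ 3 1) => //; apply: trunc.
have wT := @weight_ge_truncation k 1 1 4 Q [:: (2, 1); (1, 2)]%N hQ isT.
exists a@_(affine_mnm (e + t) 0 0), b@_(affine_mnm (d + t) 0 0), Q@_(affine_mnm k 2 1), Q@_(affine_mnm k 1 2).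
rewrite (_ : _ - _ = Q - \sum_(u <- [:: (2, 1); (1, 2)]%N) Q@_(affine_mnm k u.1 u.2) *: 'X_[affine_mnm k u.1 u.2]).
  apply: wT => x y lt nz.
  have [le1|lt1] := leqP 4 (1 * x + 2 * y); last first.
    by move: nz; rewrite wQ ?eqxx // plane_weightE affine_mnm_ix affine_mnm_iy.
  have [le2|lt2] := leqP 4 (2 * x + 1 * y); last first.
    by move: nz; rewrite wQ' ?eqxx // plane_weightE affine_mnm_ix affine_mnm_iy.
  have [ex|ex] : x = 2%N \/ x = 1%N by move: lt le1 le2; clear; lia.
    by rewrite ex (_ : y = 1%N) //; move: lt le1 le2; rewrite ex; clear; lia.
  by rewrite ex (_ : y = 2%N) //; move: lt le1 le2; rewrite ex; clear; lia.
rewrite !big_cons big_nil /= addr0.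
have -> : f * a + h * b = Q + (a@_(affine_mnm (e + t) 0 0) *: (f * 'X_[affine_mnm (e + t) 0 0])
    + b@_(affine_mnm (d + t) 0 0) *: (h * 'X_[affine_mnm (d + t) 0 0])).
  by rewrite /Q /a' /b' -!mul_mpolyC; ring.
by rewrite -[in X in _ - X]addrA opprD addrA addrK.
Qed.

End LocalConditions.

(** Exponents below 10 cover all monomials of weight less than [N] when [p] and [q] are positive and
    [N <= 10]. *)
Definition low_mnm_count p q N : nat :=
  #|[pred u : 'I_10 * 'I_10 | (p * u.1 + q * u.2 < N)%N]|.

(** * Local multiplicities against the Bezout number *)

Section GlobalCount.
Variable K : numFieldType.

Lemma dim_forms k : \dim {: dhomog 3 K k} = 'C(k + 2, k).
Proof. by rewrite dimvf. Qed.

(** The Koszul count: it gives codimension [d * e] to the ideal in degree [d + (e + t)]. *)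
Lemma dim_forms_alternating d e t :
  ('C(d + (e + t) + 2, d + (e + t)) + 'C(t + 2, t) =
    'C(e + t + 2, e + t) + 'C(d + t + 2, d + t) + d * e)%N.
Proof.
have bin k : ('C(k + 2, k) * 2 = (k + 2) * (k + 1))%N.
  have -> : 'C(k + 2, k) = 'C(k + 2, 2) by rewrite -{2}[k](addnK 2) bin_sub ?leq_addl.
  by have := bin_ffact (k + 2) 2; rewrite !ffactnS ffactn0 muln1 addn2 addn1.
have := bin (d + (e + t))%N; have := bin t; have := bin (e + t)%N; have := bin (d + t)%N.
by clear; nia.
Qed.

Variables (d e : nat) (F H : {mpoly K[3]}).
Hypotheses (F0 : F != 0) (hF : F \is d.-homog) (hH : H \is e.-homog).
Hypothesis F_reg : forall b, divides F (H * b) -> divides F b.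
Variables (T : finType) (A : T -> 'M[K]_3) (p q N : T -> nat).
Hypothesis A_unit : forall i, A i \in unitmx.
Hypothesis A_distinct : forall i j, i != j ->
  ~ exists c, forall r, A i r iz = c * A j r iz.
Hypotheses (p_gt0 : forall i, (0 < p i)%N) (q_gt0 : forall i, (0 < q i)%N).
Hypothesis N_le10 : forall i, (N i <= 10)%N.
Hypothesis gen4 : forall t i, (3 <= t)%N ->
  four_generated (A i) (p i) (q i) (N i) d e t F H.

(** The low coefficients at all points are independent conditions on forms of large degree, and the
    ideal fills at most four dimensions at each point; the rest is bounded by its codimension
    [d * e]. *)
Theorem local_intersection_bound :
  (\sum_i low_mnm_count (p i) (q i) (N i) <= d * e + 4 * #|T|)%N.
Proof.
(* Large enough for interpolation in degree [k], and at least 3 as [gen4] requires. *)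
pose t := (100 * #|T| + 10)%N; pose k := (d + (e + t))%N.
pose low (x : T * ('I_10 * 'I_10)) := (p x.1 * x.2.1 + q x.1 * x.2.2 < N x.1)%N.
pose J := {x | low x}.
have lowE (x : T * ('I_10 * 'I_10)) : low x -> (x.2.1 + x.2.2 < 10)%N.
  rewrite /low => lt; apply: leq_trans (N_le10 x.1); apply: leq_ltn_trans lt.
  by apply: leq_add; apply: leq_pmull.
have cardJ : #|{: J}| = \sum_i low_mnm_count (p i) (q i) (N i).
  rewrite card_sig -sum1_card /low_mnm_count.
  under [RHS]eq_bigr => i _ do rewrite -sum1_card.
  by rewrite pair_big_dep /=; apply: eq_bigl => -[i u].
(* All low coefficients at once, each read in the coordinates of its point. *)
pose th (G : dhomog 3 K k) : {ffun J -> K^o} :=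
  [ffun j : J => (linear_change (A (val j).1) (val G))@_(affine_mnm k (val j).2.1 (val j).2.2)].
have th_lin : linear th.
  move=> c G G'; apply/ffunP=> j; rewrite !ffunE.
  have -> : val (c *: G + G') = c *: val G + val G' by [].
  by rewrite linear_changeD linear_changeZ mcoeffD mcoeffZ.
pose thL : {linear _ -> _} := HB.pack th (GRing.isLinear.Build _ _ _ _ th th_lin).
have thE v : linfun thL v = th v by apply: lfunE.
have [U [UP dimU]] := degree_ideal_dim t F0 hF hH F_reg.
have := @local_conditions_count K (dhomog 3 K k) J T (fun j => (val j).1) (linfun thL) U 4 _ _.
rewrite cardJ => bound.
suff : (\sum_i low_mnm_count (p i) (q i) (N i) + \dim U <= \dim {: dhomog 3 K k} + #|T| * 4)%N.
  move: dimU; rewrite !dim_forms; have := dim_forms_alternating d e t.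
  by rewrite /k; clear; lia.
apply: bound => [[[i0 [a b]] low0]|i].
  have ab := lowE _ low0; have [|G hG [Gi Gi0]] := @interpolation K T A A_unit A_distinct i0 a b k ab.
    by rewrite /k /t; lia.
  exists (DHomog hG) => -[[i [a' b']] lowj]; rewrite lfunE ffunE /=.
  have ab' := lowE _ lowj; have wm : (weight (plane_weight 1 1) (affine_mnm k a' b') < 10)%N.
    by rewrite plane_weightE affine_mnm_ix affine_mnm_iy !mul1n.
  rewrite -val_eqE /= !xpair_eqE; have [ei|ii0] := eqVneq i i0; last by rewrite Gi.
  have := Gi0 _ wm; rewrite ei mcoeffB => /eqP; rewrite subr_eq0 => /eqP ->.
  rewrite mcoeffX /= (_ : (_ == _) = (a' == a) && (b' == b)) //.
  apply/eqP/andP => [em|[/eqP-> /eqP->] //].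
  split; apply/eqP/val_inj.
    by have := affine_mnm_ix k a' b'; rewrite -em affine_mnm_ix.
  by have := affine_mnm_iy k a' b'; rewrite -em affine_mnm_iy.
have [|xs [hxs gen]] := gen4 (t := t) i; first by rewrite /t; lia.
have hx j : tnth xs j \is k.-homog by [].
exists [tuple DHomog (hx j) | j < 4] => u uU.
have [a [b [ha hb defu]]] := UP u uU; have [c wc] := gen a b ha hb.
exists (\sum_j c j *: DHomog (hx j)).
  apply: memv_suml => j _; apply: memvZ; apply: memv_span.
  by apply/tnthP; exists j; rewrite tnth_mktuple.
move=> [[i' [a' b']] lowj] /= ei; rewrite !thE !ffunE /=; apply/eqP; rewrite -subr_eq0.
rewrite -mcoeffB -linear_changeB; subst i'.
have -> : val (\sum_j c j *: DHomog (hx j)) = \sum_j c j *: tnth xs j.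
  by rewrite raddf_sum /=.
rewrite defu wc // plane_weightE affine_mnm_ix affine_mnm_iy.
exact: lowj.
Qed.

End GlobalCount.

Lemma low_mnm_count_cusp : low_mnm_count 3 2 10 = 12%N.
Proof.
rewrite /low_mnm_count -sum1_card (eq_bigl (fun u : 'I_10 * 'I_10 => true && (3 * u.1 + 2 * u.2 < 10)%N)) //.
rewrite -(pair_big_dep xpredT (fun i j : 'I_10 => (3 * i + 2 * j < 10)%N) (fun _ _ => 1%N)) /=.
by do !rewrite big_mkcond !big_ord_recr big_ord0 /=.
Qed.

Lemma low_mnm_count_node : low_mnm_count 1 1 4 = 10%N.
Proof.
rewrite /low_mnm_count -sum1_card (eq_bigl (fun u : 'I_10 * 'I_10 => true && (1 * u.1 + 1 * u.2 < 4)%N)) //.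
rewrite -(pair_big_dep xpredT (fun i j : 'I_10 => (1 * i + 1 * j < 4)%N) (fun _ _ => 1%N)) /=.
by do !rewrite big_mkcond !big_ord_recr big_ord0 /=.
Qed.

(** * Tangent cones *)

Section TangentCone.
Variable K : numFieldType.
Implicit Types (F G : {mpoly K[3]}) (A B : 'M[K]_3).

(** The line through the origin in direction (a, b). The coefficients of the restriction to it are
    the homogeneous parts of G(x, y, 1) evaluated at (a, b). *)
Definition cone_point (a b : K) (i : 'I_3) : {poly K} :=
  if i == ix then a *: 'X else if i == iy then b *: 'X else 1.

Definition on_cone a b G : {poly K} := mmap polyC (cone_point a b) G.

Lemma horner_on_cone a b G t : (on_cone a b G).[t] = G.@[fun i => (cone_point a b i).[t]].
Proof.
rewrite /on_cone; elim/mpoly_alg_ind: G => [c|i|p q IHp IHq|p q IHp IHq].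
- by rewrite mmapC hornerC mevalC.
- by rewrite mmapX mmap1U mevalXU.
- by rewrite [mmap _ _ _]raddfD hornerD mevalD IHp IHq.
- by rewrite [mmap _ _ _]rmorphM hornerM mevalM IHp IHq.
Qed.

Lemma coef_on_cone a b G n : (on_cone a b G)`_n =
  \sum_(m <- msupp G) G@_m * (a ^+ m ix * b ^+ m iy * (n == m ix + m iy)%N%:R).
Proof.
rewrite /on_cone /mmap coef_sum; apply: eq_bigr => m _; rewrite coefCM; congr (_ * _).
rewrite /mmap1 prod3 /cone_point /= expr1n mulr1 !exprZn -scalerAl -scalerAr scalerA.
by rewrite -exprD coefZ coefXn.
Qed.

Lemma coef_on_coneD a b G G' n :
  (on_cone a b (G + G'))`_n = (on_cone a b G)`_n + (on_cone a b G')`_n.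
Proof. by rewrite [on_cone _ _ _]raddfD coefD. Qed.

Lemma coef_on_cone_mnm a b c k x y n :
  (on_cone a b (c *: 'X_[affine_mnm k x y]))`_n = c * (a ^+ x * b ^+ y * (n == x + y)%N%:R).
Proof.
rewrite /on_cone mmapZ mmapX coefCM; congr (_ * _).
rewrite /mmap1 prod3 /cone_point /= expr1n mulr1 !exprZn -scalerAl -scalerAr scalerA.
by rewrite -exprD coefZ coefXn affine_mnm_ix affine_mnm_iy.
Qed.

Lemma coef_on_cone_ge a b G N n : weight_ge (plane_weight 1 1) N G -> (n < N)%N ->
  (on_cone a b G)`_n = 0.
Proof.
move=> wG nN; rewrite coef_on_cone big1 // => m _; case: eqP => [e|_]; last by rewrite !mulr0.
by rewrite wG ?mul0r // plane_weightE !mul1n -e.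
Qed.

Lemma coef_on_cone_quadratic d a b G n : G \is d.-homog -> (n < 3)%N ->
  (on_cone a b G)`_n =
    \sum_(u <- [:: (0, 0); (1, 0); (0, 1); (2, 0); (1, 1); (0, 2)]%N)
       G@_(affine_mnm d u.1 u.2) * (a ^+ u.1 * b ^+ u.2 * (n == u.1 + u.2)%N%:R).
Proof.
move=> hG n3; set L := [:: _; _; _; _; _; _].
have := @weight_ge_truncation K d 1 1 3 G L hG isT.
set R := G - _ => wR; rewrite (_ : G = R + \sum_(u <- L) G@_(affine_mnm d u.1 u.2) *: 'X_[affine_mnm d u.1 u.2]); last by rewrite subrK.
rewrite coef_on_coneD (@coef_on_cone_ge _ _ _ 3) ?add0r //; last first.
  apply: wR => x y lt _; move: lt; rewrite /L; clear.
  by case: x => [|[|[|x]]]; case: y => [|[|[|y]]] //; rewrite !mul1n; lia.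
rewrite subrK [on_cone _ _ _]raddf_sum coef_sum; apply: eq_bigr => u _.
exact: coef_on_cone_mnm.
Qed.

Lemma coef0_on_cone d a b G : G \is d.-homog -> (on_cone a b G)`_0 = G@_(affine_mnm d 0 0).
Proof.
move=> hG; rewrite (coef_on_cone_quadratic _ _ hG) // !big_cons big_nil /=.
do 6!move: (G@_ _); move=> g g' g2 g3 g4 g5; ring.
Qed.

Lemma coef1_on_cone d a b G : G \is d.-homog ->
  (on_cone a b G)`_1 = G@_(affine_mnm d 1 0) * a + G@_(affine_mnm d 0 1) * b.
Proof.
move=> hG; rewrite (coef_on_cone_quadratic _ _ hG) // !big_cons big_nil /=.
do 6!move: (G@_ _); move=> g g' g2 g3 g4 g5; ring.
Qed.

Lemma coef2_on_cone d a b G : G \is d.-homog ->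
  (on_cone a b G)`_2 = G@_(affine_mnm d 2 0) * a ^+ 2 + G@_(affine_mnm d 1 1) * (a * b)
    + G@_(affine_mnm d 0 2) * b ^+ 2.
Proof.
move=> hG; rewrite (coef_on_cone_quadratic _ _ hG) // !big_cons big_nil /=.
do 6!move: (G@_ _); move=> g g' g2 g3 g4 g5; ring.
Qed.

(** A quadratic form is determined by its values at (1, 0), (0, 1) and (1, 1). *)
Lemma tangent_cone_coefs d G (Q : K -> K -> K) : G \is d.-homog ->
  (forall a b, [/\ (on_cone a b G)`_0 = 0, (on_cone a b G)`_1 = 0 & (on_cone a b G)`_2 = Q a b]) ->
  [/\ G@_(affine_mnm d 0 0) = 0, G@_(affine_mnm d 1 0) = 0, G@_(affine_mnm d 0 1) = 0 &
   [/\ G@_(affine_mnm d 2 0) = Q 1 0, G@_(affine_mnm d 0 2) = Q 0 1 &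
    G@_(affine_mnm d 1 1) = Q 1 1 - Q 1 0 - Q 0 1]].
Proof.
move=> hG cone.
have [a0 a1 a2] := cone 1 0; have [_ b1 b2] := cone 0 1; have [_ _ c2] := cone 1 1.
move: a0 a1 a2 b1 b2 c2.
rewrite (coef0_on_cone _ _ hG) !(coef1_on_cone _ _ hG) !(coef2_on_cone _ _ hG).
do 6!move: (G@_ _); move=> g5 g4 g3 g2 g1 g0 a0 a1 a2 b1 b2 c2.
split=> //; [by rewrite -a1; ring|by rewrite -b1; ring|].
by split; [rewrite -a2; ring|rewrite -b2; ring|rewrite -c2 -a2 -b2; ring].
Qed.

(** For the weights 1, 2 the monomials below weight 3 are 1, x, x^2, y, and symmetrically for 2, 1:
    none survives when the 2-jet is c x y. *)
Lemma node_weights d G (c : K) : G \is d.-homog ->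
  (forall a b, [/\ (on_cone a b G)`_0 = 0, (on_cone a b G)`_1 = 0 & (on_cone a b G)`_2 = c * (a * b)]) ->
  [/\ weight_ge (plane_weight 1 2) 3 G, weight_ge (plane_weight 2 1) 3 G &
     G@_(affine_mnm d 1 1) = c].
Proof.
move=> hG /(tangent_cone_coefs hG)[g00 g10 g01 [g20 g02 ->]].
rewrite !(mulr0, mul0r) in g20 g02; split; last by rewrite !(mulr0, mul0r, mulr1, subr0).
  have := @weight_ge_truncation K d 1 2 3 G [::] hG isT; rewrite big_nil subr0; apply.
  move=> x y lt; apply: contraNT => _; move: lt; clear -g00 g10 g01 g20 g02.
  by case: x => [|[|[|x]]]; case: y => [|[|y]]; rewrite ?(g00, g10, g01, g20) ?eqxx // => lt; exfalso; move: lt; clear; lia.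
have := @weight_ge_truncation K d 2 1 3 G [::] hG isT; rewrite big_nil subr0; apply.
move=> x y lt; apply: contraNT => _; move: lt; clear -g00 g10 g01 g20 g02.
by case: x => [|[|x]]; case: y => [|[|[|y]]]; rewrite ?(g00, g10, g01, g02) ?eqxx // => lt; exfalso; move: lt; clear; lia.
Qed.

(** The monomials below weight 6 are 1, x, y, y^2, x y. All cubic monomials have weight at least 6,
    so the 2-jet suffices. *)
Lemma cusp_weight d G (c : K) : G \is d.-homog ->
  (forall a b, [/\ (on_cone a b G)`_0 = 0, (on_cone a b G)`_1 = 0 & (on_cone a b G)`_2 = c * a ^+ 2]) ->
  weight_ge (plane_weight 3 2) 6 G.
Proof.
move=> hG /(tangent_cone_coefs hG)[g00 g10 g01 [_ g02 g11]].
rewrite expr0n /= mulr0 in g02; rewrite !expr1n expr0n /= mulr0 !mulr1 subr0 subrr in g11.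
have := @weight_ge_truncation K d 3 2 6 G [::] hG isT; rewrite big_nil subr0; apply.
move=> x y lt; apply: contraNT => _; move: lt; clear -g00 g10 g01 g02 g11.
by case: x => [|[|x]]; case: y => [|[|[|y]]]; rewrite ?(g00, g10, g01, g02, g11) ?eqxx // => lt; exfalso; move: lt; clear; lia.
Qed.

Lemma meval_homog d G (c : K) (v w : 'I_3 -> K) : G \is d.-homog ->
  (forall i, w i = c * v i) -> G.@[w] = c ^+ d * G.@[v].
Proof.
move=> /dhomogP hG wv; rewrite !mevalE mulr_sumr; apply: eq_big_seq => m /hG /= <-.
rewrite !prod3 !wv !exprMn mdegE sumn3 !exprD; ring.
Qed.

Lemma weight_ge1_vanish p q G (v : 'I_3 -> K) : weight_ge (plane_weight p q) 1 G ->
  v ix = 0 -> v iy = 0 -> G.@[v] = 0.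
Proof.
move=> wG vx vy; rewrite mevalE big1 // => m _; rewrite prod3 vx vy !expr0n.
case: eqP => [mx|_]; last by rewrite !mul0r mulr0.
case: eqP => [my|_]; last by rewrite !(mul0r, mulr0).
by rewrite wG ?mul0r // plane_weightE mx my !muln0.
Qed.

Lemma mderiv_xy_ez d G : G \is d.+2.-homog -> (mderiv ix (mderiv iy G)).@[ez_point K] = G@_(affine_mnm d.+2 1 1).
Proof.
move=> hG; have hD : mderiv ix (mderiv iy G) \is d.-homog.
  exact: (mderiv_homog ix (mderiv_homog iy hG)).
have := @weight_ge_truncation K d 1 1 1 _ [:: (0, 0)]%N hD isT; rewrite big_seq1 /=.
set D := mderiv ix _; set c := D@_ _ => w.
have {}w : weight_ge (plane_weight 1 1) 1 (D - c *: 'X_[affine_mnm d 0 0]).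
  by apply: w => x y; rewrite !mul1n ltnS leqn0 addn_eq0 => /andP[/eqP-> /eqP->].
have := @weight_ge1_vanish _ _ _ (ez_point K) w erefl erefl.
rewrite mevalB mevalZ mevalX prod3 affine_mnm_ix affine_mnm_iy !expr0 !mul1r /ez_point eqxx expr1n mulr1.
move/eqP; rewrite subr_eq0 => /eqP->; rewrite /c /D !mcoeff_deriv affine_mnm_ix mnmDE affine_mnm_iy mnm1E /=.
congr (G@_ _); apply/mnmP; apply: ord3P; rewrite /affine_mnm !mnmDE !mulmnE !mnm1E /=; clear; lia.
Qed.

Lemma mderiv2_linear_change_ez A G i j :
  (mderiv i (mderiv j (linear_change A G))).@[ez_point K] =
    \sum_k \sum_l A k j * (A l i * (mderiv l (mderiv k G)).@[fun r => A r iz]).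
Proof.
rewrite mderiv_linear_change.
have -> : mderiv i (\sum_k A k j *: linear_change A (mderiv k G)) =
    \sum_k mderiv i (A k j *: linear_change A (mderiv k G)) by apply: linear_sum.
rewrite raddf_sum; apply: eq_bigr => k _ /=.
rewrite mderivZ mderiv_linear_change mevalZ raddf_sum mulr_sumr; apply: eq_bigr => l _ /=.
by rewrite mevalZ meval_linear_change_ez.
Qed.

(* The Hessian matrix has rank at most one at a cusp and rank two at a node. *)
Lemma node_cusp_disjoint d F A B c : F \is d.+2.-homog -> A \in unitmx -> B \in unitmx ->
  weight_ge (plane_weight 1 2) 3 (linear_change A F) ->
  weight_ge (plane_weight 2 1) 3 (linear_change A F) ->
  (linear_change A F)@_(affine_mnm d.+2 1 1) != 0 ->
  weight_ge (plane_weight 3 2) 6 (linear_change B F) ->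
  ~ (forall i, A i iz = c * B i iz).
Proof.
move=> hF AU BU w12 w21 nz w32 AB.
pose M := invmx B *m A; pose G := linear_change B F.
have GA : linear_change A F = linear_change M G.
  by rewrite /G linear_change_comp /M mulmxA mulmxV // mul1mx.
have Mez i : M i iz = c * (i == iz)%:R.
  rewrite /M mxE; under eq_bigr => j _ do rewrite AB mulrCA.
  rewrite -mulr_sumr; congr (c * _).
  by have := mulVmx BU => /matrixP/(_ i iz); rewrite !mxE.
(* In the cusp coordinates only the second derivative G_xx can be nonzero at the point: any other
   pair of derivatives costs at most 3 + 2 = 5 out of weight 6. *)
have Hv i j : i != ix \/ j != ix -> (mderiv i (mderiv j G)).@[fun k => M k iz] = 0.
  move=> ij; apply: (@weight_ge1_vanish 3 2); rewrite ?Mez ?mulr0 //.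
  apply: (@weight_geW _ _ _ (6 - plane_weight 3 2 j - plane_weight 3 2 i)).
    by move: ij; elim/ord3P: i; elim/ord3P: j => // -[].
  by do 2!apply: weight_ge_mderiv.
pose h := (mderiv ix (mderiv ix G)).@[fun k => M k iz].
have HA i j : (mderiv i (mderiv j (linear_change A F))).@[ez_point K] = M ix i * M ix j * h.
  rewrite GA mderiv2_linear_change_ez (bigD1 ix) //= [X in _ + X]big1 => [|k kx].
    rewrite (bigD1 ix) //= big1 => [|l lx]; last by rewrite Hv ?mulr0 //; left.
    by rewrite -/h; ring.
  by rewrite big1 // => l _; rewrite Hv ?mulr0 //; right.
(* At the node the xx-derivative vanishes, so [M ix ix] or [h] is zero; then the xy-derivative
   vanishes too, against the nonzero coefficient of x y. *)
have xx : M ix ix * M ix ix * h = 0.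
  rewrite -HA; apply: (@weight_ge1_vanish 1 2) => //.
  exact: (@weight_ge_mderiv _ _ _ _ _ ix (@weight_ge_mderiv _ _ _ _ _ ix w12)).
have := mderiv_xy_ez (linear_change_homog A hF); rewrite HA => xy.
move: nz; rewrite -xy => /negP; apply; move/eqP: xx; rewrite -!mulrA !mulf_eq0.
by case/or3P => ->; rewrite ?orbT.
Qed.

End TangentCone.

(** * The bound 8c + 6n <= 3d(d - 2) *)

Section CuspidalCurve.
Variables (K : numClosedFieldType) (d : nat) (F : {mpoly K[3]}).
Variables (I J : finType) (A : I -> 'M[K]_3) (B : J -> 'M[K]_3).
Hypotheses (hF : F \is d.+2.-homog) (F_irr : irreducible_elt F).
Hypotheses (A_unit : forall i, A i \in unitmx) (B_unit : forall j, B j \in unitmx).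
Hypothesis A_cusp : forall i, weight_ge (plane_weight 3 2) 6 (linear_change (A i) F).
Hypothesis B_node : forall j,
  [/\ weight_ge (plane_weight 1 2) 3 (linear_change (B j) F),
      weight_ge (plane_weight 2 1) 3 (linear_change (B j) F) &
      (linear_change (B j) F)@_(affine_mnm d.+2 1 1) != 0].
Hypothesis A_distinct : forall i i', i != i' -> ~ exists c, forall r, A i r iz = c * A i' r iz.
Hypothesis B_distinct : forall j j', j != j' -> ~ exists c, forall r, B j r iz = c * B j' r iz.
Hypothesis singular_covered : forall v, (exists i, v i != 0) -> F.@[v] = 0 ->
  (forall i, (mderiv i F).@[v] = 0) ->
  (exists i c, forall r, v r = c * A i r iz) \/ (exists j c, forall r, v r = c * B j r iz).

Lemma not_divides_hessian : ~ divides F (hessian F).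
Proof.
have [F0 _ _] := F_irr.
pose pts (t : I + J) r := match t with inl i => A i r iz | inr j => B j r iz end.
have [|v [v0 Fv Fi]] := @exists_smooth_point K d.+1 F (I + J)%type pts hF F0.
  move=> v v0 Fv dv; case: (singular_covered v0 Fv dv) => [[i h]|[j h]].
    by exists (inl i).
  by exists (inr j).
exact: (hessian_not_divisible hF F_irr v0 Fv Fi).
Qed.

Lemma cusp_node_distinct i j : ~ exists c, forall r, A i r iz = c * B j r iz.
Proof.
case=> c h; have [w12 w21 nz] := B_node j.
have c0 : c != 0.
  apply/eqP => c0; have /matrixP/(_ iz iz) : invmx (A i) *m A i = 1%:M := mulVmx (A_unit i).
  rewrite !mxE sum3 !h c0 !mul0r !mulr0 !addr0 eqxx => /eqP.
  by rewrite eq_sym oner_eq0.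
apply: (node_cusp_disjoint hF (B_unit j) (A_unit i) w12 w21 nz (A_cusp i) (c := c^-1)).
by move=> r; rewrite h mulKf.
Qed.

Theorem cuspidal_curve_bound : (8 * #|I| + 6 * #|J| <= 3 * d.+2 * d)%N.
Proof.
have [F0 _ _] := F_irr; have [_ _ Fprime] := irreducible_prime_mpoly F_irr.
pose H := hessian F; have hH : H \is (3 * d).-homog.
  by have := hessian_homog hF; rewrite -[(d.+2 - 2)%N]/((d - 0)%N) subn0.
have reg b : divides F (H * b) -> divides F b.
  by case/Fprime => // /not_divides_hessian.
pose C (t : I + J) := match t with inl i => A i | inr j => B j end.
pose p (t : I + J) : nat := (if t is inl _ then 3 else 1)%N.
pose q (t : I + J) : nat := (if t is inl _ then 2 else 1)%N.
pose N (t : I + J) : nat := (if t is inl _ then 10 else 4)%N.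
have CU t : C t \in unitmx by case: t.
have C_distinct t t' : t != t' -> ~ exists c, forall r, C t r iz = c * C t' r iz.
  case: t t' => [i|j] [i'|j'] ne.
  - by apply: A_distinct; apply: contra ne => /eqP->.
  - exact: cusp_node_distinct.
  - case=> c h; apply: (@cusp_node_distinct i' j); exists c^-1 => r.
    rewrite -[A i' r iz]/(C (inl i') r iz) -[B j r iz]/(C (inr j) r iz) h mulKf //.
    apply/eqP => c0; have /matrixP/(_ iz iz) := mulVmx (B_unit j).
    rewrite !mxE sum3 -![B j _ iz]/(C (inr j) _ iz) !h c0 !mul0r !mulr0 !addr0 eqxx => /eqP.
    by rewrite eq_sym oner_eq0.
  - by apply: B_distinct; apply: contra ne => /eqP->.
have wH A0 w n : A0 \in unitmx -> weight_ge w n (linear_change A0 F) ->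
    weight_ge w (3 * n - 2 * \sum_i w i) (linear_change A0 H).
  move=> AU /weight_ge_hessian; rewrite hessian_linear_change => h.
  rewrite (_ : linear_change A0 H = (\det A0) ^- 2 *: ((\det A0) ^+ 2 *: linear_change A0 H)).
    exact: weight_geZ.
  by rewrite scalerA mulVf ?scale1r // expf_neq0 // -unitfE -unitmxE.
have gen t s : (3 <= t)%N -> four_generated (C s) (p s) (q s) (N s) d.+2 (3 * d) t F H.
  move=> t3; case: s => [i|j].
    (* The Hessian has weight at least 3 * 6 - 2 * (3 + 2) = 8 at a cusp, and 3 * 3 - 2 * (1 + 2) =
       3 at a node. *)
    have := wH _ _ _ (A_unit i) (A_cusp i); rewrite sumn3 => wHi.
    exact: (four_generated_cusp (A_unit i) hF hH (A_cusp i) wHi (ltnW (ltnW t3))).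
  have [w12 w21 _] := B_node j.
  have := wH _ _ _ (B_unit j) w12; have := wH _ _ _ (B_unit j) w21.
  rewrite !sumn3 => wH21 wH12.
  exact: (four_generated_node (B_unit j) hF hH w12 w21 wH12 wH21 t3).
have := @local_intersection_bound K d.+2 (3 * d) F H F0 hF hH reg (I + J)%type C p q N
  CU C_distinct _ _ _ gen.
rewrite big_sumType /= !sum_nat_const low_mnm_count_cusp low_mnm_count_node card_sum => bound.
have := bound _ _ _; rewrite mulnCA mulnA => le.
have : (#|I| * 12 + #|J| * 10 <= 3 * d.+2 * d + 4 * (#|I| + #|J|))%N.
  by apply: le; case.
by move: (3 * d.+2 * d)%N #|I| #|J| => x a b; clear; lia.
Qed.

End CuspidalCurve.

End PlaneForms.

From mathcomp Require Import all_boot all_order all_algebra complex.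
From mathcomp Require Import all_classical all_reals all_analysis.
From mathcomp Require Import (canonicals, coercions) mpoly.

Import Order.TTheory GRing.Theory Num.Theory numFieldNormedType.Exports.
Import PlaneForms.
Local Open Scope classical_set_scope.
Local Open Scope card_scope.
Local Open Scope ring_scope.

(** * Analytic germs *)

Section OrderOfVanishing.
Variable K : numFieldType.
Implicit Types (e f : K -> K) (w : K -> 'rV[K]_2).

(** [e t] is O(t^k) at 0; the neighbourhood is punctured so that division by [t] is possible. *)
Definition vanishes_to (k : nat) e : Prop :=
  exists2 C : K, 0 <= C & \forall t \near (0 : K)^', `|e t| <= C * `|t| ^+ k.

Lemma near0_le (r : K) : 0 < r -> \forall t \near (0 : K)^', `|t| <= r.
Proof.
move=> r0; apply: cvg_within; near=> t; apply/ltW.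
near: t; apply/nbhs_ballP; exists r => //= t; rewrite /ball /= sub0r normrN //.
Unshelve. all: by end_near.
Qed.

Lemma vanishes_to_ext k e f : (\forall t \near (0 : K)^', e t = f t) ->
  vanishes_to k e -> vanishes_to k f.
Proof.
move=> ef [C C0 h]; exists C => //; near=> t.
have <- : e t = f t by near: t.
by near: t.
Unshelve. all: by end_near.
Qed.

Lemma vanishes_toD k e f : vanishes_to k e -> vanishes_to k f ->
  vanishes_to k (fun t => e t + f t).
Proof.
move=> [C C0 hC] [D D0 hD]; exists (C + D); first exact: addr_ge0.
near=> t; rewrite mulrDl; apply: le_trans (ler_normD _ _) _.
by apply: lerD; near: t.
Unshelve. all: by end_near.
Qed.

Lemma vanishes_toM k l e f : vanishes_to k e -> vanishes_to l f ->
  vanishes_to (k + l) (fun t => e t * f t).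
Proof.
move=> [C C0 hC] [D D0 hD]; exists (C * D); first exact: mulr_ge0.
near=> t; rewrite normrM exprD mulrACA.
by apply: ler_pM => //; near: t.
Unshelve. all: by end_near.
Qed.

Lemma vanishes_to_cst (c : K) : vanishes_to 0 (fun=> c).
Proof. by exists `|c| => //; near=> t; rewrite expr0 mulr1. Unshelve. all: by end_near. Qed.

Lemma vanishes_toZ k (c : K) e : vanishes_to k e -> vanishes_to k (fun t => c * e t).
Proof. by move=> h; rewrite -[k]add0n; apply: vanishes_toM => //; apply: vanishes_to_cst. Qed.

Lemma vanishes_toN k e : vanishes_to k e -> vanishes_to k (fun t => - e t).
Proof. by case=> C C0 h; exists C => //; near=> t; rewrite normrN; near: t. Unshelve. all: by end_near. Qed.

Lemma vanishes_toB k e f : vanishes_to k e -> vanishes_to k f ->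
  vanishes_to k (fun t => e t - f t).
Proof. by move=> he hf; apply: vanishes_toD => //; apply: vanishes_toN. Qed.

Lemma vanishes_to_id : vanishes_to 1 (fun t => t).
Proof. by exists 1 => //; near=> t; rewrite mul1r. Unshelve. all: by end_near. Qed.

Lemma vanishes_to_exp k : vanishes_to k (fun t => t ^+ k).
Proof. by exists 1 => //; near=> t; rewrite mul1r normrX. Unshelve. all: by end_near. Qed.

Lemma vanishes_toW k l e : (l <= k)%N -> vanishes_to k e -> vanishes_to l e.
Proof.
move=> lk [C C0 h]; exists C => //; near=> t.
have t1 : `|t| <= 1 by near: t; apply: near0_le.
apply: (@le_trans _ _ (C * `|t| ^+ k)); first by near: t.
by apply: ler_wpM2l => //; apply: ler_wiXn2l.
Unshelve. all: by end_near.
Qed.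

Lemma vanishes_to_horner0 (q : {poly K}) : vanishes_to 0 (fun t => q.[t]).
Proof.
elim/poly_ind: q => [|q c IH].
  apply: (@vanishes_to_ext 0 (fun=> 0)); last exact: vanishes_to_cst.
  by near=> t; rewrite horner0.
apply: (@vanishes_to_ext 0 (fun t => q.[t] * t + c)).
  by near=> t; rewrite hornerMXaddC.
apply: vanishes_toD; last exact: vanishes_to_cst.
by apply: (@vanishes_toW 1) => //; apply: (@vanishes_toM 0 1) => //; apply: vanishes_to_id.
Unshelve. all: by end_near.
Qed.

Lemma vanishes_to_cst0 (c : K) : vanishes_to 1 (fun=> c) -> c = 0.
Proof.
case=> C C0 h; apply/eqP/negPn/negP => c0.
(* With [t] of this size, [C * |t|] is less than [|c|]; adding 1 to [C] keeps the denominator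
   nonzero when [C] is 0. *)
have r0 : 0 < `|c| / (2 * (C + 1)).
  by rewrite divr_gt0 ?normr_gt0 // mulr_gt0 // ltr_wpDl.
have /filter_ex[t [h1 h2]] :
    \forall t \near (0 : K)^', `|c| <= C * `|t| ^+ 1 /\ `|t| <= `|c| / (2 * (C + 1)).
  by apply: filterI => //; apply: near0_le.
have : `|c| <= C * (`|c| / (2 * (C + 1))).
  by apply: le_trans h1 _; rewrite expr1 ler_wpM2l.
rewrite mulrCA -ler_pdivrMl ?normr_gt0 // mulVf ?normr_eq0 //.
rewrite ler_pdivlMr ?mulr_gt0 // ?ltr_wpDl // mul1r => h4.
have : C + 1 + (C + 1) <= C + 0.
  by rewrite addr0 -mulr2n -mulr_natl.
rewrite -addrA lerD2l => h5; have : 0 < 1 + (C + 1) by rewrite ltr_pwDl // addr_ge0.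
by move=> /lt_geF; rewrite h5.
Qed.

(** The constant coefficient is O(t), hence zero; then divide by [t] and repeat. This turns analytic
    estimates into algebraic identities. *)
Lemma vanishes_to_horner k (q : {poly K}) i : vanishes_to k (fun t => q.[t]) ->
  (i < k)%N -> q`_i = 0.
Proof.
elim: k q i => // k IH q i; elim/poly_ind: q => [|q c _] h; first by rewrite coef0.
have c0 : c = 0.
  apply: vanishes_to_cst0.
  apply: (@vanishes_to_ext 1 (fun t => (q * 'X + c%:P).[t] - q.[t] * t)).
    by near=> t; rewrite hornerMXaddC addrC addKr.
  apply: vanishes_toB; first exact: vanishes_toW h.
  by apply: (@vanishes_toM 0 1); [exact: vanishes_to_horner0|exact: vanishes_to_id].
rewrite c0 addr0 coefMX in h *; case: i => // i; rewrite ltnS; apply: IH.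
have [C C0 hC] := h; exists C => //; near=> t.
have t0 : t != 0 by near: t; apply: nbhs_dnbhs_neq.
have : `|(q * 'X).[t]| <= C * `|t| ^+ k.+1 by near: t.
by rewrite hornerMX normrM exprSr mulrA ler_pM2r ?normr_gt0.
Unshelve. all: by end_near.
Qed.

End OrderOfVanishing.

(** * First order expansion of analytic functions *)

Section AnalyticExpansion.
Variable K : numFieldType.
Implicit Types (f : 'rV[K]_2 -> K) (p h : 'rV[K]_2) (w : K -> 'rV[K]_2).

Lemma ord2P (P : 'I_2 -> Prop) : P 0 -> P 1 -> forall i, P i.
Proof.
move=> h0 h1 [[|[|//]] lt].
  by have -> : Ordinal lt = 0 by apply: ord_inj.
by have -> : Ordinal lt = 1 by apply: ord_inj.
Qed.

Lemma near_rV2 (P : 'rV[K]_2 -> Prop) p : (\forall z \near p, P z) ->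
  exists2 r : K, 0 < r & forall h, `|h 0 0| <= r -> `|h 0 1| <= r -> P (p + h).
Proof.
move=> /nbhs_ballP[r /= r0 rP]; exists (r / 2); first exact: divr_gt0.
have half (x y : K) : `|y| <= r / 2 -> ball x r (x + y).
  move=> le; rewrite /ball /= opprD addrA subrr sub0r normrN; apply: le_lt_trans le _.
  by rewrite ltr_pdivrMr // mulr_natr mulr2n ltrDl.
move=> h h0 h1; apply: rP; split=> // i j; rewrite (ord1 i) mxE; apply: half.
by elim/ord2P: j.
Qed.

Lemma vanishes_to1_small (e : K -> K) (r : K) : 0 < r -> vanishes_to 1 e ->
  \forall t \near (0 : K)^', `|e t| <= r.
Proof.
move=> r0 [C C0 hC]; have C1 : 0 < C + 1 by rewrite ltr_wpDl.
near=> t; apply: (@le_trans _ _ (C * `|t| ^+ 1)); first by near: t.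
have : `|t| <= r / (C + 1) by near: t; apply: near0_le; apply: divr_gt0.
rewrite expr1 ler_pdivlMr // mulrC mulrDl mul1r => le.
by apply: le_trans le; rewrite lerDl.
Unshelve. all: by end_near.
Qed.

Lemma near_along P p w : (\forall z \near p, P z) ->
  (forall j, vanishes_to 1 (fun t => w t 0 j)) -> \forall t \near (0 : K)^', P (p + w t).
Proof.
move=> /near_rV2[r r0 rP] hw.
by near=> t; apply: rP; near: t; apply: vanishes_to1_small.
Unshelve. all: by end_near.
Qed.

(** The indices 0 and 1 are left out because the square partial sums contain all the terms of degree
    at most one only from index 2 on. *)
Lemma cvg_norm_le (s : nat -> K) (l c B : K) : 0 <= B -> s @ \oo --> l ->
  (forall n, (2 <= n)%N -> `|s n - c| <= B) -> `|l - c| <= B.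
Proof.
move=> B0 sl sB; apply/ler_addgt0Pr => e e0.
have /filter_ex[n [n2 en]] : \forall n \near \oo, (2 <= n)%N /\ `|l - s n| < e.
  apply: filterI; first by exists 2%N.
  by move/cvgrPdist_lt: sl; apply.
rewrite -(subrK (s n) l) -addrA; apply: le_trans (ler_normD _ _) _.
by rewrite [B + e]addrC; apply: lerD; [apply: ltW|apply: sB].
Qed.

(** Two of the factors of the monomial are bounded by [|x| + |y|], the others by [rho]. *)
Lemma monomial_remainder (rho x y : K) i j : 0 < rho -> `|x| <= rho -> `|y| <= rho ->
  (2 <= i + j)%N ->
  `|x| ^+ i * `|y| ^+ j <= rho ^+ i * rho ^+ j * ((`|x| + `|y|) / rho) ^+ 2.
Proof.
move=> r0 xr yr ij; set s := `|x| + `|y|.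
have s0 : 0 <= s by apply: addr_ge0.
have xs : `|x| <= s by rewrite lerDl.
have ys : `|y| <= s by rewrite lerDr.
have bound k l : (k + l = 2)%N -> (k <= i)%N -> (l <= j)%N ->
    `|x| ^+ i * `|y| ^+ j <= rho ^+ i * rho ^+ j * (s / rho) ^+ 2.
  move=> kl ki lj.
  have one (z : K) m n : `|z| <= rho -> `|z| <= s -> (m <= n)%N -> `|z| ^+ n <= rho ^+ n * (s / rho) ^+ m.
    move=> zr zs mn; have -> : rho ^+ n * (s / rho) ^+ m = rho ^+ (n - m) * s ^+ m.
      rewrite -{1}(subnK mn) exprD expr_div_n -mulrA; congr (_ * _).
      by rewrite mulrC divfK // expf_neq0 // lt0r_neq0.
    rewrite -{1}(subnK mn) exprD; by apply: ler_pM; rewrite ?exprn_ge0 // lerXn2r ?nnegrE ?(ltW r0).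
  rewrite -kl exprD mulrACA; apply: ler_pM; rewrite ?exprn_ge0 //; exact: one.
have [i0|i0] := posnP i; first by apply: (bound 0%N 2%N) => //; rewrite i0 in ij.
have [i1|i1] := eqVneq i 1%N; first by apply: (bound 1%N 1%N) => //; rewrite i1 in ij.
by apply: (bound 2%N 0%N) => //; rewrite ltn_neqAle eq_sym i1.
Qed.

(** The terms of degree at least two are compared with the absolutely convergent series at the
    corner (r, r) of a polydisc. *)
Lemma analytic_expansion f p : analytic_at f p ->
  exists a b C r : K, [/\ 0 <= C, 0 < r & forall h, `|h 0 0| <= r -> `|h 0 1| <= r ->
    `|f (p + h) - (f p + a * h 0 0 + b * h 0 1)| <= C * (`|h 0 0| + `|h 0 1|) ^+ 2].
Proof.
case=> a /near_rV2[r r0 sums].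
have sums' h : `|h 0 0| <= r -> `|h 0 1| <= r -> power_series_sums_to a h (f (p + h)).
  by move=> h0 h1; have := sums h h0 h1; rewrite add0r.
pose hr : 'rV[K]_2 := const_mx r.
have [||[M bM] _] := sums' hr; rewrite ?mxE ?ger0_norm ?(ltW r0) //.
have M0 : 0 <= M by have := bM 0%N; rewrite big_ord0.
(* [M] bounds the series of norms at (r, r), and each remainder term gains the factor ((|h0| + |h1|)
   / r)^2. *)
pose C := M / r ^+ 2.
have C0 : 0 <= C by rewrite divr_ge0 // exprn_ge0 // ltW.
have key h : `|h 0 0| <= r -> `|h 0 1| <= r ->
    `|f (p + h) - (a 0%N 0%N + a 1%N 0%N * h 0 0 + a 0%N 1%N * h 0 1)| <= C * (`|h 0 0| + `|h 0 1|) ^+ 2.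
  move=> h0 h1; have [_ cv] := sums' h h0 h1.
  apply: (cvg_norm_le _ cv) => [|n n2]; first by rewrite mulr_ge0 // exprn_ge0 // addr_ge0.
  case: n n2 => [|[|n]] // _.
  pose t (i j : 'I_n.+2) := a i j * h 0 0 ^+ i * h 0 1 ^+ j.
  pose lowp (i j : 'I_n.+2) := (i + j < 2)%N.
  have split : \sum_(i < n.+2) \sum_(j < n.+2) t i j =
      \sum_(i < n.+2) \sum_(j < n.+2 | lowp i j) t i j + \sum_(i < n.+2) \sum_(j < n.+2 | ~~ lowp i j) t i j.
    by rewrite -big_split; apply: eq_bigr => i _; rewrite (bigID (lowp i)).
  have -> : \sum_(i < n.+2) \sum_(j < n.+2) a i j * h 0 0 ^+ i * h 0 1 ^+ j
     = \sum_(i < n.+2) \sum_(j < n.+2) t i j by [].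
  rewrite split.
  have -> : \sum_(i < n.+2) \sum_(j < n.+2 | lowp i j) t i j =
     a 0%N 0%N + a 1%N 0%N * h 0 0 + a 0%N 1%N * h 0 1.
    have r0E : \sum_(j < n.+2 | lowp ord0 j) t ord0 j = a 0%N 0%N + a 0%N 1%N * h 0 1.
      rewrite big_mkcond !big_ord_recl big1 ?addr0 => [|j _]; last by [].
      by rewrite /lowp /t /= /bump /= ?addr0 ?add0r !expr0 !mulr1 expr1.
    have r1E : \sum_(j < n.+2 | lowp (lift ord0 ord0) j) t (lift ord0 ord0) j = a 1%N 0%N * h 0 0.
      rewrite big_mkcond !big_ord_recl big1 ?addr0 => [|j _]; last by [].
      by rewrite /lowp /t /= /bump /= ?addr0 ?add0r !expr0 !mulr1 expr1.
    rewrite !big_ord_recl r0E r1E big1 => [|i _]; last by rewrite big_pred0.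
    by rewrite addr0 -addrA [_ * h 0 1 + _]addrC addrA.
  rewrite addrAC subrr add0r.
  apply: (@le_trans _ _ (\sum_(i < n.+2) \sum_(j < n.+2) `|a i j * hr 0 0 ^+ i * hr 0 1 ^+ j| * ((`|h 0 0| + `|h 0 1|) / r) ^+ 2)).
    apply: le_trans (ler_norm_sum _ _ _) _; apply: ler_sum => i _.
    apply: le_trans (ler_norm_sum _ _ _) _; rewrite big_mkcond; apply: ler_sum => j _.
    rewrite /lowp -leqNgt; case: ifP => ij; last first.
      by rewrite mulr_ge0 ?normr_ge0 // exprn_ge0 // divr_ge0 ?addr_ge0 // ltW.
    rewrite /t !normrM !normrX !mxE (gtr0_norm r0) -!mulrA ler_wpM2l //.
    by rewrite [X in _ <= X]mulrA; apply: monomial_remainder.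
  under eq_bigr do rewrite -mulr_suml.
  rewrite -mulr_suml (_ : C * _ = M * ((`|h 0 0| + `|h 0 1|) / r) ^+ 2); last first.
    by rewrite /C expr_div_n mulrAC -mulrA.
  apply: ler_wpM2r; last exact: bM.
  by rewrite exprn_ge0 // divr_ge0 ?addr_ge0 // ltW.
have f0 : f p = a 0%N 0%N.
  have := key 0; rewrite !mxE normr0 ltW // !mulr0 !addr0 => /(_ isT isT).
  by rewrite expr0n mulr0 normr_le0 subr_eq0 => /eqP.
by exists (a 1%N 0%N), (a 0%N 1%N), C, r; split=> // h; rewrite f0; apply: key.
Qed.

End AnalyticExpansion.

(** * Quadratic part of a local equation *)

Section LocalEquation.
Variable K : numFieldType.
Implicit Types (f g : 'rV[K]_2 -> K) (phi : 'rV[K]_2 -> 'rV[K]_2) (p q v : 'rV[K]_2)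
  (w : K -> 'rV[K]_2).

Definition vanishes_to1 w := forall j, vanishes_to 1 (fun t => w t 0 j).

Lemma analytic_along f p : analytic_at f p ->
  exists a b : K, forall w, vanishes_to1 w ->
    vanishes_to 2 (fun t => f (p + w t) - f p - (a * w t 0 0 + b * w t 0 1)).
Proof.
move=> /analytic_expansion[a [b [C [r [C0 r0 bound]]]]]; exists a, b => w hw.
have [D D0 hD] : vanishes_to 2 (fun t => C * ((`|w t 0 0| + `|w t 0 1|) * (`|w t 0 0| + `|w t 0 1|))).
  have hn j : vanishes_to 1 (fun t => `|w t 0 j|).
    by have [B B0 hB] := hw j; exists B => //; near=> t; rewrite normr_id; near: t.
  by apply: vanishes_toZ; apply: (@vanishes_toM _ 1 1); apply: vanishes_toD.
exists D => //; near=> t.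
have w0 : `|w t 0 0| <= r by near: t; apply: vanishes_to1_small.
have w1 : `|w t 0 1| <= r by near: t; apply: vanishes_to1_small.
rewrite -addrA -opprD addrA; apply: le_trans (bound _ w0 w1) _.
rewrite expr2 -[leLHS]ger0_norm; last by rewrite mulr_ge0 // mulr_ge0 // addr_ge0.
by near: t.
Unshelve. all: by end_near.
Qed.

(** [D] is the transpose of the Jacobian matrix, as it acts on row vectors from the right. *)
Lemma analytic_map_along phi p : analytic_map_at phi p ->
  exists D : 'M[K]_2, forall w, vanishes_to1 w ->
    forall j, vanishes_to 2 (fun t => (phi (p + w t) - phi p - w t *m D) 0 j).
Proof.
move=> hphi.
have [a0 [b0 h0]] := analytic_along (hphi 0).
have [a1 [b1 h1]] := analytic_along (hphi 1).
exists (\matrix_(i, j) (if j == 0 then (if i == 0 then a0 else b0) else (if i == 0 then a1 else b1))).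
move=> w hw; apply: ord2P.
  apply: vanishes_to_ext (h0 w hw); near=> t.
  by rewrite !mxE !big_ord_recl big_ord0 !mxE /= addr0 (_ : lift ord0 ord0 = 1) ?(mulrC a0) ?(mulrC b0) //; apply: ord_inj.
apply: vanishes_to_ext (h1 w hw); near=> t.
by rewrite !mxE !big_ord_recl big_ord0 !mxE /= addr0 (_ : lift ord0 ord0 = 1) ?(mulrC a1) ?(mulrC b1) //; apply: ord_inj.
Unshelve. all: by end_near.
Qed.

Lemma vanishes_to1_line v : vanishes_to1 (fun t => t *: v).
Proof.
move=> j; apply: (@vanishes_to_ext _ 1 (fun t => v 0 j * t)).
  by near=> t; rewrite mxE mulrC.
by apply: vanishes_toZ; apply: vanishes_to_id.
Unshelve. all: by end_near.
Qed.

Lemma vanishes_to_linear (c : K) : vanishes_to 2 (fun t => c * t) -> c = 0.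
Proof.
move=> h; have := @vanishes_to_horner K 2 (c *: 'X) 1; rewrite coefZ coefX mulr1; apply=> //.
by apply: vanishes_to_ext h; near=> t; rewrite hornerZ hornerX.
Unshelve. all: by end_near.
Qed.

(** The 2-jet of [g] at 0 is the form [Q], tested along all curves with a first order expansion, so
    that the property can be composed with a change of coordinates. *)
Definition quadratic_part g (Q : K -> K -> K) : Prop :=
  forall w (c0 c1 : K),
    vanishes_to 2 (fun t => w t 0 0 - c0 * t) -> vanishes_to 2 (fun t => w t 0 1 - c1 * t) ->
    vanishes_to 3 (fun t => g (w t) - Q c0 c1 * t ^+ 2).

Lemma tangent_vanishes_to1 (e : K -> K) (c : K) :
  vanishes_to 2 (fun t => e t - c * t) -> vanishes_to 1 e.
Proof.
move=> h; apply: (@vanishes_to_ext _ 1 (fun t => (e t - c * t) + c * t)).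
  by near=> t; rewrite subrK.
apply: vanishes_toD; first exact: vanishes_toW h.
by apply: vanishes_toZ; apply: vanishes_to_id.
Unshelve. all: by end_near.
Qed.

Lemma node_quadratic_part : quadratic_part (@node_equation K) (fun x y => x * y).
Proof.
move=> w c0 c1 h0 h1.
apply: (@vanishes_to_ext _ 3 (fun t => (w t 0 0 - c0 * t) * w t 0 1 + c0 * (t * (w t 0 1 - c1 * t)))).
  by near=> t; rewrite /node_equation; ring.
apply: vanishes_toD.
  by apply: (@vanishes_toM _ 2 1) => //; apply: tangent_vanishes_to1 h1.
by apply: vanishes_toZ; apply: (@vanishes_toM _ 1 2) => //; apply: vanishes_to_id.
Unshelve. all: by end_near.
Qed.

Lemma cusp_quadratic_part : quadratic_part (@cusp_equation K) (fun x y => x ^+ 2).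
Proof.
move=> w c0 c1 h0 h1.
apply: (@vanishes_to_ext _ 3 (fun t => (w t 0 0 - c0 * t) * w t 0 0 + c0 * (t * (w t 0 0 - c0 * t))
    - w t 0 1 * (w t 0 1 * w t 0 1))).
  by near=> t; rewrite /cusp_equation; ring.
have v0 := tangent_vanishes_to1 h0; have v1 := tangent_vanishes_to1 h1.
apply: vanishes_toB; last by apply: (@vanishes_toM _ 1 2) => //; apply: (@vanishes_toM _ 1 1).
apply: vanishes_toD; first exact: (@vanishes_toM _ 2 1).
by apply: vanishes_toZ; apply: (@vanishes_toM _ 1 2) => //; apply: vanishes_to_id.
Unshelve. all: by end_near.
Qed.

(** Along a line through [p], the map [phi] is linear up to O(t^2) and the factor [u] is constant up
    to O(t); hence the 2-jet of [f] is [u p] times [Q] composed with the linear part [D] of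
    [phi]. *)
Lemma local_equation_quadratic_part f p g Q : quadratic_part g Q ->
  analytically_equivalent f p g 0 ->
  exists2 D : 'M[K]_2, D \in unitmx & exists2 c : K, c != 0 & forall v,
    vanishes_to 3 (fun t => f (p + t *: v) - c * Q ((v *m D) 0 0) ((v *m D) 0 1) * t ^+ 2).
Proof.
move=> gQ [phi [u [[phip hphi [psi [psi0 hpsi psiphi _]]] hu up def]]].
have [D hD] := analytic_map_along hphi; have [D' hD'] := analytic_map_along hpsi.
pose y v t := phi (p + t *: v).
have yE v j : vanishes_to 2 (fun t => y v t 0 j - (v *m D) 0 j * t).
  apply: vanishes_to_ext (hD _ (vanishes_to1_line v) j); near=> t.
  by rewrite phip subr0 -scalemxAl !mxE mulrC.
have y1 v : vanishes_to1 (y v) by move=> j; apply: tangent_vanishes_to1 (yE v j).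
(* The inverse map gives a left inverse of the differential: expand
   [psi (phi (p + t *: v)) = p + t *: v] to first order. *)
have DD' v : v *m D *m D' = v.
  apply/rowP=> j; apply/eqP; rewrite -subr_eq0; apply/eqP/vanishes_to_linear.
  have h1 := hD' _ (y1 v) j.
  have h2 : vanishes_to 2 (fun t => (y v t 0 0 - (v *m D) 0 0 * t) * D' 0 j +
                                    (y v t 0 1 - (v *m D) 0 1 * t) * D' 1 j).
    by apply: vanishes_toD; apply: (@vanishes_toM _ 2 0) => //; apply: vanishes_to_cst.
  apply: vanishes_to_ext (vanishes_toN (vanishes_toD h1 h2)); near=> t.
  have eqp : psi (0 + y v t) = p + t *: v.
    rewrite add0r /y; near: t; exact: (near_along psiphi (vanishes_to1_line v)).
  have sum2 (F : 'I_2 -> K) : \sum_i F i = F 0 + F 1.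
    rewrite !big_ord_recl big_ord0 addr0; congr (_ + F _); exact: ord_inj.
  have mxB (M N : 'rV[K]_2) : (M - N) 0 j = M 0 j - N 0 j by rewrite !mxE.
  have mxM (M : 'rV[K]_2) : (M *m D') 0 j = M 0 0 * D' 0 j + M 0 1 * D' 1 j.
    by rewrite mxE sum2.
  have mxZ (M : 'rV[K]_2) : (t *: M) 0 j = t * M 0 j by rewrite mxE.
  by rewrite eqp psi0 [p + _]addrC addrK mxB !mxM mxZ; ring.
have Dunit : D \in unitmx.
  have /mulmx1_unit[] : D *m D' = 1%:M; last by [].
  by apply/row_matrixP=> i; rewrite -{1}(mul1mx D) !row_mul DD'.
exists D => //; exists (u p) => // v.
have [a [b hu1]] := analytic_along hu.
have u1 : vanishes_to 1 (fun t => u (p + t *: v) - u p).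
  have h := hu1 _ (vanishes_to1_line v).
  apply: (@vanishes_to_ext _ 1 (fun t => (u (p + t *: v) - u p - (a * (t *: v) 0 0 + b * (t *: v) 0 1))
     + (a * (t *: v) 0 0 + b * (t *: v) 0 1))).
    by near=> t; rewrite subrK.
  apply: vanishes_toD; first exact: vanishes_toW h.
  by apply: vanishes_toD; apply: vanishes_toZ; apply: vanishes_to1_line.
have gy := gQ (y v) _ _ (yE v 0) (yE v 1).
have g2 : vanishes_to 2 (fun t => g (y v t)).
  apply: (@vanishes_to_ext _ 2 (fun t => (g (y v t) - Q ((v *m D) 0 0) ((v *m D) 0 1) * t ^+ 2) +
     Q ((v *m D) 0 0) ((v *m D) 0 1) * t ^+ 2)).
    by near=> t; rewrite subrK.
  by apply: vanishes_toD; [exact: vanishes_toW gy|apply: vanishes_toZ; apply: vanishes_to_exp].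
apply: vanishes_to_ext (vanishes_toD (vanishes_toM u1 g2) (vanishes_toZ (u p) gy)); near=> t.
have -> : f (p + t *: v) = u (p + t *: v) * g (phi (p + t *: v)).
  near: t; exact: (near_along def (vanishes_to1_line v)).
by rewrite -/(y v t); ring.
Unshelve. all: by end_near.
Qed.

End LocalEquation.

(** * Local equations of the curve *)

Section LocalCoordinates.
Variable K : numFieldType.
Implicit Types (F : mpoly.mpoly 3 K) (z : 'rV[K]_2) (D : 'M[K]_2) (P : P2 K).

(** The last column is the point and the other two are the rows of [invmx D], completed by 0 in
    position [k]: in these coordinates the differential [D] becomes the identity. *)
Definition chart_matrix k z D : 'M[K]_3 :=
  \matrix_(i, j) (if j == iz then chart k z 0 i
                  else if unlift k i is Some l then invmx D (if j == ix then 0 else 1) l else 0).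

Definition row2 (a b : K) : 'rV[K]_2 := \row_l (if l == 0 then a else b).

Lemma row2_mul a b D l : (row2 a b *m D) 0 l = a * D 0 l + b * D 1 l.
Proof.
rewrite mxE !big_ord_recl big_ord0 addr0 !mxE /= (_ : lift ord0 ord0 = 1) //.
exact: ord_inj.
Qed.

Lemma chart_matrix_ez k z D i : chart_matrix k z D i iz = chart k z 0 i.
Proof. by rewrite mxE eqxx. Qed.

Lemma chart_matrix_cone k z D a b t i :
  \sum_j chart_matrix k z D i j * (cone_point a b j).[t] =
    chart k (z + t *: (row2 a b *m invmx D)) 0 i.
Proof.
rewrite sum3 !mxE /cone_point /= hornerC mulr1 !hornerZ hornerX.
case: (unlift k i) => [l|]; last by rewrite !mul0r !add0r.
have -> : (z + t *: (row2 a b *m invmx D)) 0 l = z 0 l + t * (row2 a b *m invmx D) 0 l.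
  by rewrite !mxE.
by rewrite row2_mul; ring.
Qed.

Lemma chart_matrix_unit k z D : D \in unitmx -> chart_matrix k z D \in unitmx.
Proof.
move=> DU; rewrite -unitmx_tr -row_free_unit; apply: inj_row_free => v v0.
have eqn i : v 0 ix * chart_matrix k z D i ix + v 0 iy * chart_matrix k z D i iy
    + v 0 iz * chart_matrix k z D i iz = 0.
  by move/matrixP/(_ 0 i): v0; rewrite [LHS]mxE sum3 ![_^T _ _]mxE [RHS]mxE.
(* In row [k] the first two entries are 0 and the last one is 1. *)
have vz : v 0 iz = 0.
  by have := eqn k; rewrite !mxE /= unlift_none !mulr0 !add0r mulr1.
have vxy : row2 (v 0 ix) (v 0 iy) = 0.
  rewrite -(mulmxK DU (row2 _ _)) -mulmxA mulmxV // mulmx1 -[LHS](mulmxKV DU).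
  rewrite (_ : _ *m invmx D = 0) ?mul0mx //; apply/rowP=> l.
  rewrite [LHS]row2_mul [RHS]mxE; have := eqn (lift k l).
  by rewrite vz mul0r addr0 !mxE /= liftK => ->.
apply/rowP; apply: ord3P; rewrite [RHS]mxE //.
  by move/rowP/(_ 0): vxy; rewrite !mxE.
by move/rowP/(_ 1): vxy; rewrite !mxE.
Qed.

Lemma horner_on_cone_chart k z D F a b t :
  (on_cone a b (linear_change (chart_matrix k z D) F)).[t] =
    eval_form F (chart k (z + t *: (row2 a b *m invmx D))).
Proof.
rewrite horner_on_cone meval_linear_change; apply: mpoly.meval_eq => i.
exact: chart_matrix_cone.
Qed.

(** In the direction [row2 a b *m invmx D] the quadratic part is [c * Q a b]. Since the restriction
    is a polynomial in t, the estimate O(t^3) determines its first three coefficients. *)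
Lemma tangent_cone_of_local_equation F g Q P : quadratic_part g Q -> has_local_equation F g P ->
  exists (A : 'M[K]_3) (r : 'rV[K]_3) (c : K),
    [/\ A \in unitmx, val P = <[r]>%VS, (forall i, A i iz = r 0 i), c != 0 &
     forall a b, let p := on_cone a b (linear_change A F) in
       [/\ p`_0 = 0, p`_1 = 0 & p`_2 = c * Q a b]].
Proof.
move=> gQ [k [z [defP equiv]]].
have [D DU [c c0 jet]] := local_equation_quadratic_part gQ equiv.
exists (chart_matrix k z D), (chart k z), c; split=> //.
- exact: chart_matrix_unit.
- exact: chart_matrix_ez.
move=> a b p.
have := jet (row2 a b *m invmx D); rewrite mulmxKV // ![row2 _ _ _ _]mxE /= => van.
have coef i : (i < 3)%N -> (p - (c * Q a b) *: 'X^2)`_i = 0.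
  apply: vanishes_to_horner; apply: vanishes_to_ext van; near=> t.
  by rewrite hornerD hornerN hornerZ hornerXn horner_on_cone_chart.
have := coef 0%N isT; have := coef 1%N isT; have := coef 2%N isT.
rewrite !coefB !coefZ !coefXn /= !mulr0 !mulr1 !subr0 => /eqP.
by rewrite subr_eq0 => /eqP-> -> ->.
Unshelve. all: by end_near.
Qed.

End LocalCoordinates.

Lemma card_eq_enum (T : Type) (A : set T) n : A #= `I_n ->
  exists f : 'I_n -> T, [/\ injective f, forall i, A (f i) & forall x, A x -> exists i, f i = x].
Proof.
move=> /card_set_bijP[g [gfun ginj gsurj]].
have pick (i : 'I_n) : exists x, A x /\ g x = i.
  by have [x Ax gx] := gsurj i (ltn_ord i); exists x.
have [f fP] := fin_all_exists pick; exists f; split=> [i j eqf|i|x Ax].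
- by apply/val_inj; rewrite /= -(fP i).2 -(fP j).2 eqf.
- exact: (fP i).1.
exists (Ordinal (gfun x Ax)); apply: ginj; rewrite ?inE //; first exact: (fP _).1.
by rewrite (fP _).2.
Qed.

(** * Points of the projective plane and the final inequality *)

Section Points.
Variable K : numFieldType.
Implicit Types (F : mpoly.mpoly 3 K) (P : P2 K) (r : 'rV[K]_3).

Lemma P2_span_neq0 P r : val P = <[r]>%VS -> r != 0.
Proof.
by move=> defP; have := valP P; rewrite /= defP dim_vline; case: (r != 0).
Qed.

Lemma P2_eq P P' r r' c : val P = <[r]>%VS -> val P' = <[r']>%VS ->
  (forall i, r 0 i = c * r' 0 i) -> P = P'.
Proof.
move=> defP defP' rr'; apply: val_inj; rewrite /= defP defP'.
apply/eqP; rewrite eqEdim !dim_vline (P2_span_neq0 defP) (P2_span_neq0 defP') leqnn andbT.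
by rewrite -memvE; apply/vlineP; exists c; apply/rowP=> i; rewrite rr' !mxE.
Qed.

Lemma singular_point_span d F r (rP : \dim <[r]> == 1%N) : form_of_degree d F ->
  mpoly.meval (fun i => r 0 i) F = 0 ->
  (forall i, mpoly.meval (fun i => r 0 i) (mpoly.mderiv i F) = 0) ->
  singular_point F (exist _ <[r]>%VS rP).
Proof.
move=> hF Fr dFr v /= /vlineP[c ->].
have scale i : (c *: r) 0 i = c * r 0 i by rewrite mxE.
rewrite /eval_form (meval_homog hF scale) Fr mulr0; split=> // i.
by rewrite (meval_homog (mderiv_homog i hF) scale) dFr mulr0.
Qed.

End Points.

Theorem mainTheorem4 (R : realType) (d c n : nat) (F : mpoly.mpoly 3%N R[i])
    (d_ge2 : (2 <= d)%N)
    (F_form : form_of_degree d F)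
    (F_irr : irreducible_elt F)
    (F_cuspidal : cuspidal F)
    (cusps : [set P : P2 R[i] | ordinary_cusp F P] #= `I_c)
    (nodes : [set P : P2 R[i] | ordinary_node F P] #= `I_n) :
  8 * c%:R + 6 * n%:R <=
    3 * d%:R * (d%:R - 2) - (1 - (-1) ^+ d) / 2 :> rat.
Proof.
have [f [f_inj f_cusp f_surj]] := card_eq_enum cusps.
have [g [g_inj g_node g_surj]] := card_eq_enum nodes.
have [e de] : exists e, d = e.+2 by exists (d - 2)%N; move: d_ge2; clear; lia.
(* From here on [d] stands for the degree minus two. *)
subst d; move: e d_ge2 F_form => d d_ge2 F_form.
have [A AP] := fin_all_exists (fun i => tangent_cone_of_local_equation
  (@cusp_quadratic_part R[i]) (f_cusp i)).
have [r rP] := fin_all_exists AP; have [cA cP] := fin_all_exists rP.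
have [B BP] := fin_all_exists (fun j => tangent_cone_of_local_equation
  (@node_quadratic_part R[i]) (g_node j)).
have [s sP] := fin_all_exists BP; have [cB cBP] := fin_all_exists sP.
have bound : (8 * c + 6 * n <= 3 * d.+2 * d)%N.
  rewrite -[c]card_ord -[n in (_ + 6 * n)%N]card_ord.
  apply: (@cuspidal_curve_bound R[i] d F 'I_c 'I_n A B F_form F_irr).
  - by move=> i; have [] := cP i.
  - by move=> j; have [] := cBP j.
  - move=> i; have [_ _ _ _ cone] := cP i.
    exact: (cusp_weight (linear_change_homog (A i) F_form) cone).
  - move=> j; have [_ _ _ c0 cone] := cBP j.
    by have [w w' ->] := node_weights (linear_change_homog (B j) F_form) cone.
  - move=> i i' /eqP ne [a eqA]; apply/ne/f_inj.
    have [_ defP er _ _] := cP i; have [_ defP' er' _ _] := cP i'.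
    by apply: (P2_eq defP defP' (c := a)) => k; rewrite -er -er'.
  - move=> j j' /eqP ne [a eqB]; apply/ne/g_inj.
    have [_ defP er _ _] := cBP j; have [_ defP' er' _ _] := cBP j'.
    by apply: (P2_eq defP defP' (c := a)) => k; rewrite -er -er'.
  move=> v [i0 vi0] Fv dFv; pose u : 'rV[R[i]]_3 := \row_i v i.
  have uv i : u 0 i = v i by rewrite mxE.
  have udim : \dim <[u]> == 1%N.
    rewrite dim_vline; suff -> : u != 0 by [].
    by apply: contraNneq vi0 => u0; rewrite -uv u0 mxE.
  (* A singular point is a cusp or a node, hence occurs in one of the two enumerations. *)
  have [||/f_surj[i fi]|/g_surj[j gj]] := F_cuspidal _ (@singular_point_span R[i] d.+2 F u udim F_form _ _).
  - by rewrite (mpoly.meval_eq _ uv).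
  - by move=> i; rewrite (mpoly.meval_eq _ uv).
  - left; exists i; have [_ defP er _ _] := cP i.
    have /vlineP[a ua] : u \in <[r i]>%VS by rewrite -defP fi memv_line.
    by exists a => k; rewrite -uv ua mxE er.
  right; exists j; have [_ defP er _ _] := cBP j.
  have /vlineP[a ua] : u \in <[s j]>%VS by rewrite -defP gj memv_line.
  by exists a => k; rewrite -uv ua mxE er.
(* The left side of [bound] is even; when the degree is odd its right side is odd, so the inequality
   is strict and one unit is gained, which is the correction term. *)
have parity : (8 * c + 6 * n + odd d <= 3 * d.+2 * d)%N.
  have [od|_] := boolP (odd d); last by rewrite addn0.
  rewrite addn1 ltn_neqAle bound andbT; apply: contraTneq od => eqn.
  by have := congr1 odd eqn; rewrite oddD !oddM [odd d.+2]/= negbK => /esym /=; case: (odd d).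
have -> : (1 - (-1) ^+ d.+2) / 2 = (odd d)%:R :> rat.
  rewrite -signr_odd [odd d.+2]/= negbK; case: (odd d).
    by rewrite expr1 opprK divff.
  by rewrite expr0 subrr mul0r.
have -> : d.+2%:R - 2 = d%:R :> rat by rewrite -addn2 natrD addrK.
by rewrite lerBrDr -!natrM -!natrD ler_nat.
Qed.
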